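(* Let $Z_1\neq Z_2$ be two points of the Euclidean space $\mathbb{R}^3$ and $m_1,m_2,f\in\mathbb{R}$. The mechanical billiard system defined in $\mathbb{R}^3$ by the Lagrange problem with force function $$m_1/\|q-Z_1\|+m_2/\|q-Z_2\|+f\,\|q-(Z_1+Z_2)/2\|^2,$$ with any finite combination (finite union) of confocal quadrics with foci at $Z_1,Z_2$ as reflection wall, is integrable. As subcases, the billiard systems with such walls defined by the spatial two-center problem ($f=0$), by the spatial Kepler problem ($m_1=f=0$ or $m_2=f=0$; one of the foci is then the Kepler center), and by the spatial Hooke problem ($m_1=m_2=0$; the quadrics are then centered at the Hooke center) are integrable. In the normalized model $(W,\|\cdot\|_a)$, with Kepler centers $\tilde Z_1=(a,0,0,-1)$, $\tilde Z_2=(-a,0,0,-1)$ and Hooke center $\tilde Z_0=(0,0,0,-1)$, the first integrals are $$E_{sp}=\tfrac12\|\dot{\tilde q}\|_a^2-\frac{m_1}{\|\tilde q-\tilde Z_1\|_a}-\frac{m_2}{\|\tilde q-\tilde Z_2\|_a}-f\|\tilde q-\tilde Z_0\|_a^2,$$ $$\tilde E_{sph}=\tfrac12\big(\dot x^2+\dot y^2+\dot z^2+(x\dot y-y\dot x)^2+(y\dot z-z\dot y)^2+(z\dot x-x\dot z)^2\big)-f(x^2+y^2+z^2)-\frac{\hat m_1(1+ax)}{\sqrt{(x-a)^2+(1+a^2)(y^2+z^2)}}-\frac{\hat m_2(1-ax)}{\sqrt{(x+a)^2+(1+a^2)(y^2+z^2)}},$$ $$L_{yz}=y\dot z-z\dot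 y,$$ where $\hat m_i=m_i\sqrt{1+a^2}$.
   Context: A natural mechanical system $(M,g,U)$ is a Riemannian manifold $(M,g)$ with a force function $U$ (smooth outside a singular set); its motions satisfy $\nabla_{\dot q}\dot q=\mathrm{grad}_g U(q)$. A first integral is a function on $TM$ constant along motions. Poisson brackets of functions on $TM$ are those obtained from the canonical bracket of $T^*M$ via $v\mapsto g(v,\cdot)$. The elastic reflection at a point $q$ of a hypersurface $\mathcal{B}$ sends $v=v_t+v_n$ to $v'=v_t-v_n$ ($v_t$ tangent, $v_n$ $g$-normal to $\mathcal{B}$). The billiard system $(M,g,U,\mathcal{B})$, $\dim M=N$, is integrable if there are $N$ functionally independent first integrals of $(M,g,U)$ (differentials linearly independent on an open dense set), pairwise in involution, each satisfying $F(q,v)=F(q,v')$ for all reflections at $\mathcal{B}$. For a finite union of quadrics, reflections are considered at every point (outside singularities of $U$) of each quadric with respect to the tangent plane of that quadric. A quadric in $\mathbb{R}^3$ (with a given Euclidean norm) is confocal with foci $Z_1,Z_2$ if it is a non-degenerate quadric which is the locus of points for which the sum of the distances to $Z_1,Z_2$ is a constant $c>\|Z_1-Z_2\|$ (spheroid), or the absolute value of the difference of these distances is a constant $c$, $0<c<\|Z_1-Z_2\|$ (circular hyperboloid of two sheets). Normalized model: $W=\{(x,y,z,-1)\}\subset\mathbb{R}^4$, $a\neq0$ real, with Euclidean norm $\|\cdot\|_a$ given by $\|(x,y,z)\|_a=\sqrt{x^2/(1+a^2)+y^2+z^2}$ (applied to the first three coordinates); the Lagrange problem in $(W,\|\cdot\|_a)$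 has force function $m_1/\|\tilde q-\tilde Z_1\|_a+m_2/\|\tilde q-\tilde Z_2\|_a+f\|\tilde q-\tilde Z_0\|_a^2$, and distances, gradients and reflections are taken with respect to $\|\cdot\|_a$. Any Lagrange problem in $\mathbb{R}^3$ is brought to this form by a similarity (with rescaled parameters). *)

(* Defs.v *)
From HB Require Import structures.
From mathcomp Require Export all_boot all_order all_algebra.
From mathcomp Require Export all_classical all_reals all_analysis.
Export Order.TTheory GRing.Theory Num.Theory numFieldNormedType.Exports.

Set Implicit Arguments.
Unset Strict Implicit.
Unset Printing Implicit Defensive.

#[global] Open Scope classical_set_scope.
#[global] Open Scope ring_scope.

(* Constant metrics on R^n, given by their Gram matrix. *)

Definition mdot (R : realType) (n : nat) (A : 'M[R]_n) (u v : 'rV[R]_n) : R :=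
  (u *m A *m v^T) 0 0.

Definition mnorm (R : realType) (n : nat) (A : 'M[R]_n) (u : 'rV[R]_n) : R :=
  Num.sqrt (mdot A u u).

Definition mdist (R : realType) (n : nat) (A : 'M[R]_n) (p q : 'rV[R]_n) : R :=
  mnorm A (p - q).

(* A natural mechanical system whose configuration manifold is the complement
   of [singular_set] in R^n with the constant metric [metric].  The value of
   [force_fun] on [singular_set] is irrelevant. *)
Record mech_system (R : realType) (n : nat) := MechSystem {
  metric : 'M[R]_n.+1;
  force_fun : 'rV[R]_n.+1 -> R;
  singular_set : set 'rV[R]_n.+1
}.

Definition phase_space (R : realType) (n : nat) (M : mech_system R n) :
    set ('rV[R]_n.+1 * 'rV[R]_n.+1) :=
  [set x | ~ singular_set M x.1].

(* The metric being constant, the covariant derivative of the velocity is the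
   ordinary second derivative; the equation reads g(q'', u) = dU_q(u). *)
Definition is_motion (R : realType) (n : nat) (M : mech_system R n)
    (I : set R) (q : R -> 'rV[R]_n.+1) : Prop :=
  forall t, I t ->
    [/\ ~ singular_set M (q t),
        derivable q t 1,
        derivable (derive1 q) t 1 &
        forall u, mdot (metric M) (derive1 (derive1 q) t) u
                  = 'd (force_fun M) (q t) u].

Fixpoint Ck_on (R : realType) (V : normedModType R) (D : set V) (k : nat)
    (F : V -> R) : Prop :=
  match k with
  | 0 => forall x, D x -> {for x, continuous F}
  | k'.+1 => (forall x, D x -> differentiable F x) /\
             (forall w, Ck_on D k' ('D_w F))
  end.

Definition smooth_on (R : realType) (V : normedModType R) (D : set V)
    (F : V -> R) : Prop :=
  forall k, Ck_on D k F.

Definition first_integral (R : realType) (n : nat) (M : mech_system R n)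
    (F : 'rV[R]_n.+1 * 'rV[R]_n.+1 -> R) : Prop :=
  smooth_on (phase_space M) F /\
  forall (I : set R) (q : R -> 'rV[R]_n.+1),
    open I -> is_interval I -> is_motion M I q ->
    forall s t, I s -> I t -> F (q s, derive1 q s) = F (q t, derive1 q t).

(* [F] read on the cotangent bundle through v |-> g(v, .), which in coordinates
   is the map v |-> v *m A. *)
Definition on_cotangent (R : realType) (n : nat) (A : 'M[R]_n.+1)
    (F : 'rV[R]_n.+1 * 'rV[R]_n.+1 -> R) : 'rV[R]_n.+1 * 'rV[R]_n.+1 -> R :=
  fun x => F (x.1, x.2 *m invmx A).

Definition canonical_bracket (R : realType) (n : nat)
    (F G : 'rV[R]_n.+1 * 'rV[R]_n.+1 -> R) (x : 'rV[R]_n.+1 * 'rV[R]_n.+1) : R :=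
  \sum_(i < n.+1)
    ('D_(delta_mx 0 i, 0) F x * 'D_(0, delta_mx 0 i) G x
     - 'D_(0, delta_mx 0 i) F x * 'D_(delta_mx 0 i, 0) G x).

Definition poisson_bracket (R : realType) (n : nat) (A : 'M[R]_n.+1)
    (F G : 'rV[R]_n.+1 * 'rV[R]_n.+1 -> R) (x : 'rV[R]_n.+1 * 'rV[R]_n.+1) : R :=
  canonical_bracket (on_cotangent A F) (on_cotangent A G) (x.1, x.2 *m A).

Definition functionally_independent (R : realType) (n k : nat)
    (M : mech_system R n)
    (F : 'I_k -> 'rV[R]_n.+1 * 'rV[R]_n.+1 -> R) : Prop :=
  exists O : set ('rV[R]_n.+1 * 'rV[R]_n.+1),
    [/\ open O, O `<=` phase_space M, phase_space M `<=` closure O &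
        forall x, O x -> forall c : 'I_k -> R,
          (forall w, \sum_i c i * 'd (F i) x w = 0) -> forall i, c i = 0].

(* Tangent vectors of the hypersurface B at q are the velocities of the curves
   lying on B. *)
Definition tangent (R : realType) (n : nat) (B : set 'rV[R]_n.+1)
    (q u : 'rV[R]_n.+1) : Prop :=
  exists gamma : R -> 'rV[R]_n.+1,
    [/\ gamma 0 = q, \forall t \near (0 : R), B (gamma t) &
        is_derive (0 : R) (1 : R) gamma u].

Definition normal (R : realType) (n : nat) (A : 'M[R]_n.+1)
    (B : set 'rV[R]_n.+1) (q u : 'rV[R]_n.+1) : Prop :=
  forall w, tangent B q w -> mdot A u w = 0.

Definition elastic_reflection (R : realType) (n : nat) (A : 'M[R]_n.+1)
    (B : set 'rV[R]_n.+1) (q v v' : 'rV[R]_n.+1) : Prop :=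
  exists vt vn, [/\ tangent B q vt, normal A B q vn, v = vt + vn & v' = vt - vn].

Definition reflection_invariant (R : realType) (n : nat) (M : mech_system R n)
    (B : set 'rV[R]_n.+1) (F : 'rV[R]_n.+1 * 'rV[R]_n.+1 -> R) : Prop :=
  forall q v v', B q -> ~ singular_set M q ->
    elastic_reflection (metric M) B q v v' -> F (q, v) = F (q, v').

(* The reflection wall is the union of the members of [walls]; reflections are
   taken separately at each member. *)
Definition integrable_by (R : realType) (n : nat) (M : mech_system R n)
    (walls : set (set 'rV[R]_n.+1))
    (F : 'I_n.+1 -> 'rV[R]_n.+1 * 'rV[R]_n.+1 -> R) : Prop :=
  [/\ forall i, first_integral M (F i),
      functionally_independent M F,
      forall i j x, phase_space M x ->
        poisson_bracket (metric M) (F i) (F j) x = 0 &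
      forall i B, walls B -> reflection_invariant M B (F i)].

Definition billiard_integrable (R : realType) (n : nat) (M : mech_system R n)
    (walls : set (set 'rV[R]_n.+1)) : Prop :=
  exists F, integrable_by M walls F.

Definition spheroid (R : realType) (A : 'M[R]_3) (Z1 Z2 : 'rV[R]_3) (c : R) :
    set 'rV[R]_3 :=
  [set q | mdist A q Z1 + mdist A q Z2 = c].

Definition hyperboloid (R : realType) (A : 'M[R]_3) (Z1 Z2 : 'rV[R]_3) (c : R) :
    set 'rV[R]_3 :=
  [set q | `|mdist A q Z1 - mdist A q Z2| = c].

(* The bounds on c are what makes these loci non-degenerate. *)
Definition confocal_quadric (R : realType) (A : 'M[R]_3) (Z1 Z2 : 'rV[R]_3)
    (B : set 'rV[R]_3) : Prop :=
  (exists2 c : R, mdist A Z1 Z2 < c & B = spheroid A Z1 Z2 c) \/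
  (exists2 c : R, 0 < c < mdist A Z1 Z2 & B = hyperboloid A Z1 Z2 c).

Definition kepler_force (R : realType) (A : 'M[R]_3) (Z : 'rV[R]_3) (m : R)
    (q : 'rV[R]_3) : R :=
  m / mdist A q Z.

Definition hooke_force (R : realType) (A : 'M[R]_3) (Z : 'rV[R]_3) (f : R)
    (q : 'rV[R]_3) : R :=
  f * mdist A q Z ^+ 2.

(* A centre with mass factor 0 is not a singularity: with the convention
   x / 0 = 0 the force function vanishes identically. *)
Definition kepler_singular (R : realType) (Z : 'rV[R]_3) (m : R) :
    set 'rV[R]_3 :=
  [set q | m != 0 /\ q = Z].

Definition kepler_system (R : realType) (A : 'M[R]_3) (Z : 'rV[R]_3) (m : R) :
    mech_system R 2 :=
  MechSystem A (kepler_force A Z m) (kepler_singular Z m).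

Definition hooke_system (R : realType) (A : 'M[R]_3) (Z : 'rV[R]_3) (f : R) :
    mech_system R 2 :=
  MechSystem A (hooke_force A Z f) set0.

Definition two_center_system (R : realType) (A : 'M[R]_3) (Z1 Z2 : 'rV[R]_3)
    (m1 m2 : R) : mech_system R 2 :=
  MechSystem A (fun q => kepler_force A Z1 m1 q + kepler_force A Z2 m2 q)
    (kepler_singular Z1 m1 `|` kepler_singular Z2 m2).

Definition lagrange_system (R : realType) (A : 'M[R]_3) (Z1 Z2 Z0 : 'rV[R]_3)
    (m1 m2 f : R) : mech_system R 2 :=
  MechSystem A
    (fun q => kepler_force A Z1 m1 q + kepler_force A Z2 m2 q
              + hooke_force A Z0 f q)
    (kepler_singular Z1 m1 `|` kepler_singular Z2 m2).

Definition vec3 (R : realType) (x y z : R) : 'rV[R]_3 :=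
  \row_i [:: x; y; z]`_i.

Definition cx (R : realType) (u : 'rV[R]_3) : R := u 0 (inord 0).
Definition cy (R : realType) (u : 'rV[R]_3) : R := u 0 (inord 1).
Definition cz (R : realType) (u : 'rV[R]_3) : R := u 0 (inord 2).

Definition euclidean (R : realType) : 'M[R]_3 := 1%:M.

(* The hyperplane W = {(x, y, z, -1)} of R^4 is coordinatised by (x, y, z);
   vectors tangent to W have fourth coordinate 0. *)
Definition metric_W (R : realType) (a : R) : 'M[R]_3 :=
  diag_mx (vec3 (1 + a ^+ 2)^-1 1 1).

Lemma mnorm_euclidean (R : realType) (u : 'rV[R]_3) :
  mnorm (euclidean R) u = Num.sqrt (cx u ^+ 2 + cy u ^+ 2 + cz u ^+ 2).
Proof.
rewrite /mnorm /mdot /euclidean mulmx1 mxE !big_ord_recr big_ord0 /= add0r !mxE.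
rewrite /cx /cy /cz -!expr2.
by congr (Num.sqrt (u _ _ ^+ 2 + u _ _ ^+ 2 + u _ _ ^+ 2));
  apply/val_inj; rewrite /= inordK.
Qed.

Lemma mnorm_W (R : realType) (a : R) (u : 'rV[R]_3) :
  mnorm (metric_W a) u
  = Num.sqrt (cx u ^+ 2 / (1 + a ^+ 2) + cy u ^+ 2 + cz u ^+ 2).
Proof.
rewrite /mnorm /mdot /metric_W mul_mx_diag mxE !big_ord_recr big_ord0 /= add0r.
rewrite !mxE /= !mulr1 mulrAC /cx /cy /cz -!expr2.
by congr (Num.sqrt (u _ _ ^+ 2 / _ + u _ _ ^+ 2 + u _ _ ^+ 2));
  apply/val_inj; rewrite /= inordK.
Qed.

Definition E_sp (R : realType) (a m1 m2 f : R) (s : 'rV[R]_3 * 'rV[R]_3) : R :=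
  let A := metric_W a in
  let: (q, v) := s in
  2^-1 * mnorm A v ^+ 2
  - m1 / mdist A q (vec3 a 0 0) - m2 / mdist A q (vec3 (- a) 0 0)
  - f * mdist A q (vec3 0 0 0) ^+ 2.

Definition E_sph (R : realType) (a m1 m2 f : R) (s : 'rV[R]_3 * 'rV[R]_3) : R :=
  let: (q, v) := s in
  let x := cx q in let y := cy q in let z := cz q in
  let dx := cx v in let dy := cy v in let dz := cz v in
  let m1' := m1 * Num.sqrt (1 + a ^+ 2) in
  let m2' := m2 * Num.sqrt (1 + a ^+ 2) in
  2^-1 * (dx ^+ 2 + dy ^+ 2 + dz ^+ 2 + (x * dy - y * dx) ^+ 2
          + (y * dz - z * dy) ^+ 2 + (z * dx - x * dz) ^+ 2)
  - f * (x ^+ 2 + y ^+ 2 + z ^+ 2)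
  - m1' * (1 + a * x)
    / Num.sqrt ((x - a) ^+ 2 + (1 + a ^+ 2) * (y ^+ 2 + z ^+ 2))
  - m2' * (1 - a * x)
    / Num.sqrt ((x + a) ^+ 2 + (1 + a ^+ 2) * (y ^+ 2 + z ^+ 2)).

Definition L_yz (R : realType) (s : 'rV[R]_3 * 'rV[R]_3) : R :=
  let: (q, v) := s in cy q * cz v - cz q * cy v.

(* Main.v *)
From HB Require Import structures.
From mathcomp Require Import ring lra.
Require Import Defs.
Set Implicit Arguments.
Unset Strict Implicit.
Unset Printing Implicit Defensive.

(* In the normalized model the three integrals are built from polynomials and
   the terms m / d, d a distance to a Kepler centre. Conservation along motions
   and involution are polynomial identities in the coordinates, after replacing
   m / d by (m / d^3) d^2. The velocity gradients of the integrals are linearly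
   independent where their determinant, a nonzero polynomial, does not vanish,
   and this set is dense. A confocal quadric is { s x^2 + b (y^2 + z^2) = 1 } with
   b = s (a^2 b + 1 + a^2); this relation makes its normal orthogonal to its
   tangent plane simultaneously for the kinetic parts of E_sp and E_sph, so both
   are unchanged by reflections, while L_yz is unchanged because the normals
   meet the axis. Everything is natural under similarities, and a Householder
   reflection followed by a scaling brings arbitrary foci to the normalized
   position. *)

(** * Locality of differentiability and of the classes C^k *)

(** Agreement near x gives g the first-order expansion of f, and [diff_unique] then identifies the
    differential of g. *)
Lemma near_eq_differentiable (R : realType) (V W : normedModType R)
    (f g : V -> W) (x : V) :
  (\near x, f x = g x) -> differentiable f x -> differentiable g x.
Proof.
move=> fg dfx; have gx : f x = g x by exact: nbhs_singleton fg.
have E : g \o shift x = cst (g x) + 'd f x +o_ 0 id.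
  apply/eqaddoE/eqaddoP => _/posnumP[e].
  have /diff_locallyP[_ /eqaddoP/(_ e%:num (gt0 e))] := dfx.
  apply: filterS2; last by move: fg; rewrite (near_shift 0) subr0; exact.
  move=> h /= fh.
  change (`|f (h + x) - (f x + 'd f x h)| <= e%:num * `|h| ->
          `|g (h + x) - (g x + 'd f x h)| <= e%:num * `|h|).
  by rewrite fh gx.
have dg := diff_unique (diff_continuous dfx) E.
by apply/diff_locallyP; rewrite dg; split => //; exact: diff_continuous.
Qed.

(** Openness of D turns agreement on D into agreement near each of its points, which directional
    derivatives inherit. *)
Lemma Ck_on_ext (R : realType) (V : normedModType R) (D : set V) (k : nat)
    (F G : V -> R) :
  open D -> (forall x, D x -> F x = G x) -> Ck_on D k F -> Ck_on D k G.
Proof.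
move=> oD; have nearD H K x : (forall x, D x -> H x = K x :> R) -> D x ->
    \near x, H x = K x.
  by move=> HK Dx; apply: filterS (open_nbhs_nbhs (conj oD Dx)) => y /HK.
elim: k F G => [|k IH] F G FG /=.
  move=> cF x Dx; have := cF x Dx; rewrite /prop_for /continuous_at FG //.
  by apply: cvg_trans; exact: near_eq_cvg (nearD _ _ _ FG Dx).
move=> [dF cF]; split=> [x Dx|w].
  exact: near_eq_differentiable (nearD _ _ _ FG Dx) (dF x Dx).
apply: IH (cF w) => x Dx.
exact: near_eq_derive (nearD _ _ _ FG Dx).
Qed.

(** * Smooth functions given by expressions *)

Section Expressions.
Variables (R : realType) (n : nat).

Notation phase := ('rV[R]_n.+1 * 'rV[R]_n.+1)%type.

(* [Over c k e] denotes c / sqrt(e)^k. Keeping the coefficient c inside makes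
   the case c = 0, where nothing is required of e, stable under
   differentiation. *)
Inductive expr :=
  | Pos of 'I_n.+1
  | Vel of 'I_n.+1
  | Cst of R
  | Add of expr & expr
  | Mul of expr & expr
  | Over of R & nat & expr.

Fixpoint eval (e : expr) (s : phase) : R :=
  match e with
  | Pos i => s.1 0 i
  | Vel i => s.2 0 i
  | Cst c => c
  | Add e1 e2 => eval e1 s + eval e2 s
  | Mul e1 e2 => eval e1 s * eval e2 s
  | Over c k e1 => c / Num.sqrt (eval e1 s) ^+ k
  end.

Fixpoint wd (e : expr) (s : phase) : Prop :=
  match e with
  | Pos _ | Vel _ | Cst _ => True
  | Add e1 e2 | Mul e1 e2 => wd e1 s /\ wd e2 s
  | Over c _ e1 => wd e1 s /\ (c != 0 -> 0 < eval e1 s)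
  end.

(** Expressions are closed under differentiation because (e^(-k/2))' = -(k/2) e^(-(k+2)/2) e', which
    is again an [Over] term, with exponent raised by 2. *)
Fixpoint deriv_expr (w : phase) (e : expr) : expr :=
  match e with
  | Pos i => Cst (w.1 0 i)
  | Vel i => Cst (w.2 0 i)
  | Cst _ => Cst 0
  | Add e1 e2 => Add (deriv_expr w e1) (deriv_expr w e2)
  | Mul e1 e2 => Add (Mul e1 (deriv_expr w e2)) (Mul e2 (deriv_expr w e1))
  | Over c k e1 => Mul (Over (- (k%:R / 2) * c) k.+2 e1) (deriv_expr w e1)
  end.

(** The coefficient of the new [Over] is a multiple of the old one: if it is nonzero, positivity of
    the radicand was already required. *)
Lemma wd_deriv_expr (w : phase) (e : expr) (s : phase) :
  wd e s -> wd (deriv_expr w e) s.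
Proof.
elim: e => //= [e1 IH1 e2 IH2|e1 IH1 e2 IH2|c k e IH] [h1 h2].
- by split; [exact: IH1|exact: IH2].
- by split; split=> //; [exact: IH2|exact: IH1].
- by split; [split=> //; rewrite mulf_eq0 negb_or => /andP[_]|exact: IH].
Qed.

Lemma is_derive_over (c : R) (k : nat) (t : R) : 0 < t ->
  is_derive t 1 (fun t => c / Num.sqrt t ^+ k)
    (- (k%:R / 2) * c / Num.sqrt t ^+ k.+2).
Proof.
move=> t0; have s0 : Num.sqrt t != 0 by rewrite gt_eqF// sqrtr_gt0.
have -> : (fun t => c / Num.sqrt t ^+ k) = c *: (fun t => (Num.sqrt t)^-1) ^+ k.
  by apply/funext => u; rewrite exprfctE scalrfctE -exprVn.
have d1 : is_derive t 1 (fun t => (Num.sqrt t)^-1)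
    (- (Num.sqrt t) ^- 2 * (2 * Num.sqrt t)^-1).
  have ds := is_derive1_sqrt t0.
  split; first by apply: derivableV => //; exact: ex_derive.
  by rewrite deriveV // derive_val.
apply: (is_derive_eq (is_deriveZ c (is_deriveX k d1))).
case: k => [|k]; first by rewrite !(mul0r, oppr0, scale0r, scaler0).
rewrite -![_ *: _]/(_ * _) /= exprVn !exprS expr0.
have : Num.sqrt t ^+ k != 0 by exact: expf_neq0.
move: s0; move: (Num.sqrt t) => u u0 p0.
by field; rewrite u0 p0.
Qed.

(** For c = 0 the function is identically zero, hence differentiable also where the square root is
    not. *)
Lemma differentiable_over (c : R) (k : nat) (t : R) : (c != 0 -> 0 < t) ->
  is_diff t (fun t => c / Num.sqrt t ^+ k)
    ( *%R (- (k%:R / 2) * c / Num.sqrt t ^+ k.+2)).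
Proof.
have [-> _|c0 /(_ isT) t0] := eqVneq c 0.
  have -> : (fun t : R => 0 / Num.sqrt t ^+ k) = cst 0.
    by apply/funext => u; rewrite mul0r.
  apply: is_diff_eq; apply/funext => u.
  by rewrite mulr0 !mul0r.
have [d e] := is_derive_over c k t0.
have D := (derivable1_diffP _ _).1 d.
apply: DiffDef => //; rewrite diff1E //; apply/funext => h.
by rewrite derive1E e /GRing.scale /= mulrC.
Qed.

Lemma is_diff_linear (V W : normedModType R) (f : V -> W) (x : V) :
  linear f -> continuous f -> is_diff x f f.
Proof.
move=> lf cf; pose F : {linear V -> W} :=
  HB.pack f (GRing.isLinear.Build _ _ _ _ f lf).
have -> : f = F by [].
by apply: DiffDef; [exact: linear_differentiable|exact: diff_lin].
Qed.

Lemma is_diff_eval (e : expr) (s : phase) :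
  wd e s -> is_diff s (eval e) (fun w => eval (deriv_expr w e) s).
Proof.
elim: e s => //=.
- move=> i s _; apply: (@is_diff_linear _ _ (fun s : phase => s.1 0 i)).
    by move=> k u v; rewrite /= !mxE.
  move=> u; apply: (@continuous_comp _ _ _ fst (fun v : 'rV[R]_n.+1 => v 0 i)).
    exact: cvg_fst.
  exact: coord_continuous.
- move=> i s _; apply: (@is_diff_linear _ _ (fun s : phase => s.2 0 i)).
    by move=> k u v; rewrite /= !mxE.
  move=> u; apply: (@continuous_comp _ _ _ snd (fun v : 'rV[R]_n.+1 => v 0 i)).
    exact: cvg_snd.
  exact: coord_continuous.
- by move=> c s _; exact: is_diff_cst.
- by move=> e1 IH1 e2 IH2 s [/IH1 d1 /IH2 d2]; exact: is_diffD.
- by move=> e1 IH1 e2 IH2 s [/IH1 d1 /IH2 d2]; have := is_diffM d1 d2.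
- move=> c k e IH s [/IH d1 /(differentiable_over k) d2].
  exact: (is_diff_comp d1 d2).
Qed.

Lemma derive_eval (e : expr) (s w : phase) :
  wd e s -> 'D_w (eval e) s = eval (deriv_expr w e) s.
Proof.
by move=> /is_diff_eval[d E]; rewrite deriveE // E.
Qed.

(** Induction on the order: on D every directional derivative is the value of an expression that is
    again well defined on D. *)
Lemma smooth_eval (D : set phase) (e : expr) :
  open D -> (forall s, D s -> wd e s) -> smooth_on D (eval e).
Proof.
move=> oD + k; elim: k e => [|k IH] e we /=.
  move=> s /we /is_diff_eval[d _]; exact: differentiable_continuous.
split=> [s /we /is_diff_eval[d _] //|w].
apply: (@Ck_on_ext _ _ _ _ (eval (deriv_expr w e))) => //.
  by move=> s Ds; rewrite derive_eval //; exact: we.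
by apply: IH => s /we; exact: wd_deriv_expr.
Qed.

End Expressions.

(** * Conserved functions and Poisson brackets *)

(** The difference quotients of the two sides are the same function of h, so their limits agree. *)
Lemma derive_comp_affine (R : realType) (U V W : normedModType R)
    (f : V -> W) (T L : U -> V) (x w : U) :
  (forall (h : R) w x, T (h *: w + x) = h *: L w + T x) ->
  'D_w (f \o T) x = 'D_(L w) f (T x).
Proof.
move=> TL; rewrite /derive; set g := fun h => _; set g' := fun h => _.
by have -> : g = g' by apply/funext => h; rewrite /g /g' /= TL.
Qed.

Lemma eq_of_derive0 (R : realType) (I : set R) (g : R -> R) :
  is_interval I -> (forall t, I t -> is_derive t 1 g 0) ->
  forall s t, I s -> I t -> g s = g t.
Proof.
move=> iI dg; suff H s t : I s -> I t -> s <= t -> g s = g t.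
  move=> s t Is It; have [st|/ltW ts] := leP s t; first exact: H.
  by apply/esym; exact: H.
move=> Is It st; have J x : x \in `[s, t] -> I x.
  by rewrite in_itv /=; exact: iI.
have [|x xst|c _] := @MVT_segment R g (fun=> 0) s t st.
- by move=> x xst; apply/dg/J/subset_itv_oo_cc.
- by apply: derivable_within_continuous => y /J /dg d; exact: ex_derive.
- by rewrite mul0r => /eqP; rewrite subr_eq0 eq_sym => /eqP.
Qed.

Section Mechanics.
Variables (R : realType) (n : nat).
Implicit Type M : mech_system R n.

(* F is infinitesimally invariant under the flow: w ranges over the
   accelerations which the equation of motion prescribes at q. *)
Definition conserved M (F : 'rV[R]_n.+1 * 'rV[R]_n.+1 -> R) : Prop :=
  forall q v w, ~ singular_set M q ->
    (forall u, mdot (metric M) w u = 'D_u (force_fun M) q) ->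
    'D_(v, w) F (q, v) = 0.

(** By the chain rule the derivative of F along a motion is its derivative in the direction (q',
    q''), and the equation of motion makes q'' an admissible w in [conserved]. *)
Lemma first_integral_of_conserved M F :
  smooth_on (phase_space M) F ->
  (forall q, ~ singular_set M q -> differentiable (force_fun M) q) ->
  conserved M F ->
  first_integral M F.
Proof.
move=> sF dU HF; split=> [|I q oI iI mq]; first exact: sF.
apply: eq_of_derive0 => // t It; have [nS d1 d2 eqm] := mq t It.
have dF : differentiable F (q t, derive1 q t) by exact: (sF 1%N).1.
have D1 := (derivable1_diffP _ _).1 d1.
have D2 := (derivable1_diffP _ _).1 d2.
have dp : differentiable (fun t => (q t, derive1 q t)) t.
  exact: differentiable_pair.
have dc : differentiable (F \o (fun t => (q t, derive1 q t))) t.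
  exact: differentiable_comp.
apply: DeriveDef; first exact: diff_derivable.
rewrite deriveE // diff_comp // /comp diff_pair //.
have E0 : 'D_(derive1 q t, derive1 (derive1 q) t) F (q t, derive1 q t) = 0.
  apply: HF => // u.
  by rewrite eqm deriveE //; exact: dU.
apply: etrans E0; rewrite deriveE //; congr ('d F _ (_, _)).
  exact: (esym (derive1E' D1)).
exact: (esym (derive1E' D2)).
Qed.

Lemma derive_on_cotangent (A : 'M[R]_n.+1) F q v w : A \in unitmx ->
  'D_w (on_cotangent A F) (q, v *m A) = 'D_(w.1, w.2 *m invmx A) F (q, v).
Proof.
move=> uA; rewrite -{2}(mulmxK uA v).
apply: (@derive_comp_affine _ _ _ _ F (fun x => (x.1, x.2 *m invmx A))
         (fun x => (x.1, x.2 *m invmx A))) => h u x.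
by rewrite /= mulmxDl -scalemxAl.
Qed.

(** With momentum p = v A one has v = p A^-1, so the derivative in the i-th momentum becomes the
    velocity derivative along row i of A^-1. *)
Lemma poisson_bracketE (A : 'M[R]_n.+1) F G q v : A \in unitmx ->
  poisson_bracket A F G (q, v) =
  \sum_(i < n.+1)
    ('D_(delta_mx 0 i, 0) F (q, v) * 'D_(0, delta_mx 0 i *m invmx A) G (q, v)
     - 'D_(0, delta_mx 0 i *m invmx A) F (q, v)
       * 'D_(delta_mx 0 i, 0) G (q, v)).
Proof.
move=> uA; have Dq H u :
    'D_(u, 0) (on_cotangent A H) (q, v *m A) = 'D_(u, 0) H (q, v).
  by rewrite (derive_on_cotangent H q v (u, 0) uA) [(_, _).1]/= [(_, _).2]/= mul0mx.
have Dv H u : 'D_(0, u) (on_cotangent A H) (q, v *m A) =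
    'D_(0, u *m invmx A) H (q, v).
  exact: derive_on_cotangent.
by apply: eq_bigr => i _; rewrite !Dq !Dv.
Qed.

Lemma poisson_bracket_self (A : 'M[R]_n.+1) F x : poisson_bracket A F F x = 0.
Proof.
have comm (b c : R) : b * c - c * b = 0 by rewrite mulrC subrr.
by apply: big1 => i _; exact: comm.
Qed.

Lemma poisson_bracket_anti (A : 'M[R]_n.+1) F G x :
  poisson_bracket A F G x = - poisson_bracket A G F x.
Proof.
by rewrite -sumrN; apply: eq_bigr => i _; rewrite opprB; congr (_ - _); rewrite mulrC.
Qed.

End Mechanics.

(** Packages directional derivatives as a linear map, which can then be expanded in a basis. *)
Lemma derive_linear (R : realType) (U V : normedModType R) (W : lmodType R)
    (F : V -> U) (x : V) (L : W -> V) :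
  linear L -> differentiable F x ->
  exists g : {linear W -> U}, forall w, 'D_(L w) F x = g w.
Proof.
move=> lL dF; have lg : linear (fun w => 'd F x (L w)).
  by move=> c u w; rewrite lL linearP.
pose g : {linear W -> U} := HB.pack (fun w => 'd F x (L w))
  (GRing.isLinear.Build _ _ _ _ (fun w => 'd F x (L w)) lg).
exists g.
by move=> w; rewrite deriveE.
Qed.

(** * Transfer along a similarity *)

Section AffineMaps.
Variables (R : realType) (n : nat).
Notation V := 'rV[R]_n.+1.
Implicit Types (P : 'M[R]_n.+1) (z q u w : V).

Lemma differentiable_mulmxr P (q : V) : differentiable (fun u : V => u *m P) q.
Proof.
rewrite (_ : (fun _ => _) = \sum_i (fun u : V => u 0 i *: row i P)).
  apply: differentiable_sum => i; apply: differentiableZl.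
  exact: differentiable_coord.
by apply/funext => u; rewrite mulmx_sum_row fct_sumE.
Qed.

Lemma is_diff_mulmxr P (q : V) :
  is_diff q (fun u : V => u *m P) (fun u : V => u *m P).
Proof.
apply: is_diff_linear; first by move=> c u w; rewrite mulmxDl -scalemxAl.
by move=> u; apply: differentiable_continuous; exact: differentiable_mulmxr.
Qed.

Definition affine P z q := (q - z) *m P.

Lemma affineE P z q : affine P z q = q *m P + affine P z 0.
Proof. by rewrite /affine sub0r mulmxBl mulNmx. Qed.

Lemma is_diff_affine P z q : is_diff q (affine P z) (fun u : V => u *m P).
Proof.
rewrite (_ : affine P z = (fun u : V => u *m P) + cst (affine P z 0)).
  apply: (is_diff_eq (is_diffD (is_diff_mulmxr P q) (is_diff_cst _ _))).
  by rewrite addr0.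
by apply/funext => u; rewrite affineE.
Qed.

Lemma affine_line P z (h : R) w q :
  affine P z (h *: w + q) = h *: (w *m P) + affine P z q.
Proof. by rewrite affineE mulmxDl -addrA -affineE scalemxAl. Qed.

(** The inverse of q |-> (q - z) P has the same form, with matrix P^-1 and base point -z P, the
    image of 0. *)
Lemma affineK P z : P \in unitmx ->
  cancel (affine P z) (affine (invmx P) (affine P z 0)).
Proof.
by move=> uP q; rewrite /affine -mulmxBl mulmxK // sub0r opprK subrK.
Qed.

Lemma affineVK P z : P \in unitmx ->
  cancel (affine (invmx P) (affine P z 0)) (affine P z).
Proof.
by move=> uP q; rewrite /affine mulmxBl mulmxKV // sub0r mulNmx opprK addrK.
Qed.

(** The tangent map of [affine]: velocities transform by the linear part alone. *)
Definition phase_map P z (x : V * V) : V * V := (affine P z x.1, x.2 *m P).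

Lemma differentiable_phase_map P z (x : V * V) : differentiable (phase_map P z) x.
Proof.
apply: differentiable_pair.
  apply: (@differentiable_comp _ _ _ _ fst (affine P z)).
    by apply: linear_differentiable => u; exact: cvg_fst.
  by have [] := is_diff_affine P z x.1.
apply: (@differentiable_comp _ _ _ _ snd (fun u => u *m P)).
  by apply: linear_differentiable => u; exact: cvg_snd.
exact: differentiable_mulmxr.
Qed.

Lemma phase_mapK P z : P \in unitmx ->
  cancel (phase_map P z) (phase_map (invmx P) (affine P z 0)).
Proof.
by move=> uP [q v]; rewrite /phase_map [LHS]/= (affineK z uP) mulmxK.
Qed.

Lemma phase_mapVK P z : P \in unitmx ->
  cancel (phase_map (invmx P) (affine P z 0)) (phase_map P z).
Proof.
by move=> uP [q v]; rewrite /phase_map [LHS]/= (affineVK z uP) mulmxKV.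
Qed.

Lemma is_derive_affine P z (g : R -> V) (t : R) u : is_derive t 1 g u ->
  is_derive t 1 (affine P z \o g) (u *m P).
Proof.
move=> [dg <-]; have Dg := (derivable1_diffP _ _).1 dg.
have [da ea] := is_diff_affine P z (g t).
have dc : differentiable (affine P z \o g) t by exact: differentiable_comp.
apply: DeriveDef; first exact: diff_derivable.
rewrite deriveE // diff_comp // /comp ea.
by congr (_ *m _); rewrite deriveE.
Qed.

Lemma tangent_affine P z (B : set V) q u :
  tangent (affine P z @^-1` B) q u -> tangent B (affine P z q) (u *m P).
Proof.
move=> [g [<- gB dg]]; exists (affine P z \o g).
by split=> //; exact: is_derive_affine.
Qed.

End AffineMaps.

(** * Pulling integrability back from N to M along a similarity *)

Section Transfer.
Variables (R : realType) (n : nat) (M N : mech_system R n).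
Variables (P : 'M[R]_n.+1) (z : 'rV[R]_n.+1) (k : R).
Notation V := 'rV[R]_n.+1.
Hypotheses (uP : P \in unitmx) (k0 : k != 0) (uN : metric N \in unitmx).
Hypothesis metricE : metric M = k *: (P *m metric N *m P^T).
Hypothesis forceE : forall q, force_fun M q = k * force_fun N (affine P z q).
Hypothesis singularE : forall q,
  singular_set M q <-> singular_set N (affine P z q).
Hypothesis dforce : forall q, ~ singular_set N q ->
  differentiable (force_fun N) q.

Let T := phase_map P z.
Let L (x : V * V) : V * V := (x.1 *m P, x.2 *m P).

Let T_line (h : R) w x : T (h *: w + x) = h *: L w + T x.
Proof. by rewrite /T /phase_map /= affine_line mulmxDl -scalemxAl. Qed.

Let derive_T (F : V * V -> R) x w : 'D_w (F \o T) x = 'D_(L w) F (T x).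
Proof. by apply: derive_comp_affine; exact: T_line. Qed.

Let phase_T x : phase_space M x <-> phase_space N (T x).
Proof. by rewrite /phase_space /=; split=> h /singularE. Qed.

Lemma mdot_metric u w :
  mdot (metric M) u w = k * mdot (metric N) (u *m P) (w *m P).
Proof.
by rewrite metricE /mdot -scalemxAr -scalemxAl mxE trmx_mul !mulmxA.
Qed.

(** The direction L w does not depend on the point, so a directional derivative of F \o T is again a
    function composed with T, and the induction applies. *)
Lemma Ck_on_T (D : set (V * V)) j F : Ck_on D j F -> Ck_on (T @^-1` D) j (F \o T).
Proof.
elim: j F => [|j IH] F /=.
  move=> cF x Dx; apply: continuous_comp (cF _ Dx).
  exact/differentiable_continuous/differentiable_phase_map.
move=> [dF cF]; split=> [x Dx|w].
  apply: differentiable_comp (dF _ Dx); exact: differentiable_phase_map.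
rewrite (_ : 'D_w (F \o T) = 'D_(L w) F \o T); first exact: IH.
by apply/funext => x; rewrite derive_T.
Qed.

Lemma smooth_T F : smooth_on (phase_space N) F ->
  smooth_on (phase_space M) (F \o T).
Proof.
move=> sF j; rewrite (_ : phase_space M = T @^-1` phase_space N); first exact: Ck_on_T.
by apply/seteqP; split=> x /phase_T.
Qed.

Let force_comp : force_fun M = k *: (force_fun N \o affine P z).
Proof. by apply/funext => u; rewrite forceE. Qed.

Let differentiable_comp_force q : ~ singular_set M q ->
  differentiable (force_fun N \o affine P z) q.
Proof.
move=> nS; apply: differentiable_comp; first by have [] := is_diff_affine P z q.
by apply: dforce => /singularE.
Qed.

Lemma differentiable_force_T q : ~ singular_set M q ->
  differentiable (force_fun M) q.
Proof.
by move=> nS; rewrite force_comp; exact/differentiableZ/differentiable_comp_force.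
Qed.

(** Metric and force function scale by the same factor k, which cancels from the equation of
    motion. *)
Lemma conserved_T F : conserved N F -> conserved M (F \o T).
Proof.
move=> cF q v w nS eqm; rewrite derive_T; apply: cF => [/singularE //|u].
apply: (mulfI k0); rewrite -[u](mulmxKV uP) -mdot_metric eqm force_comp.
rewrite deriveZ; last exact/diff_derivable/differentiable_comp_force.
rewrite (@derive_comp_affine _ _ _ _ _ _ (fun u => u *m P)) //.
by move=> h y x; exact: affine_line.
Qed.

Lemma first_integral_T F : smooth_on (phase_space N) F -> conserved N F ->
  first_integral M (F \o T).
Proof.
move=> sF cF; apply: first_integral_of_conserved.
- exact: smooth_T.
- exact: differentiable_force_T.
- exact: conserved_T.
Qed.

Lemma independent_T m (F : 'I_m -> V * V -> R) :
  (forall i, smooth_on (phase_space N) (F i)) ->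
  functionally_independent N F ->
  functionally_independent M (fun i => F i \o T).
Proof.
move=> sF [D [oD DN ND H]]; exists (T @^-1` D); split.
- apply: open_comp => // x _.
  exact/differentiable_continuous/differentiable_phase_map.
- by move=> x /DN /phase_T.
- move=> x /phase_T /ND cD B Bx.
  (* Density is pulled back through the inverse S of T, which turns a neighbourhood of x into a
     neighbourhood of T x. *)
  pose S := phase_map (invmx P) (affine P z 0).
  have : nbhs (T x) (S @^-1` B).
    have := differentiable_continuous
      (differentiable_phase_map (invmx P) (affine P z 0) (T x)).
    by apply; rewrite /T phase_mapK.
  by move=> /cD[y [Dy By]]; exists (S y); split=> //=; rewrite /S /T (phase_mapVK z uP).
- move=> x Dx c Hc; apply: (H _ Dx) => w.
  have dF i : differentiable (F i) (T x) by apply: (sF i 1%N).1; exact: DN.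
  rewrite -[RHS](Hc (w.1 *m invmx P, w.2 *m invmx P)); apply: eq_bigr => i _.
  congr (_ * _).
  have dc : differentiable (F i \o T) x.
    by apply: differentiable_comp => //; exact: differentiable_phase_map.
  have e : 'D_w (F i) (T x) = 'D_(w.1 *m invmx P, w.2 *m invmx P) (F i \o T) x.
    by rewrite derive_T /L [(_, _).1]/= [(_, _).2]/= !mulmxKV // -surjective_pairing.
  exact: etrans (esym (deriveE w (dF i))) (etrans e (deriveE _ dc)).
Qed.

Lemma metric_M_unit : metric M \in unitmx.
Proof.
by rewrite metricE unitmxZ ?unitfE // !unitmx_mul uN unitmx_tr uP.
Qed.

(** Inverting [metricE]: momenta transform by the inverse transpose of P, up to the factor k^-1. *)
Lemma invmx_metric (u : V) :
  u *m invmx (metric M) *m P = k^-1 *: (u *m invmx P^T *m invmx (metric N)).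
Proof.
set X := k^-1 *: _.
have uE : u = X *m invmx P *m metric M.
  rewrite metricE -scalemxAr !mulmxA mulmxKV // /X -!scalemxAl scalerA mulfV //.
  by rewrite scale1r mulmxKV // mulmxKV // unitmx_tr.
by rewrite uE mulmxK ?metric_M_unit // mulmxKV.
Qed.

(** The rows of P and those of the inverse transpose of P are dual bases, and the contraction of f
    and g is the same for every pair of dual bases. *)
Lemma sum_dual_basis (f g : {linear V -> R}) :
  \sum_i f (delta_mx 0 i *m P) * g (delta_mx 0 i *m invmx P^T) =
  \sum_i f (delta_mx 0 i) * g (delta_mx 0 i).
Proof.
have lin_sum (h : {linear V -> R}) u : h u = \sum_j u 0 j * h (delta_mx 0 j).
  rewrite {1}(row_sum_delta u) linear_sum; apply: eq_bigr => j _.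
  by rewrite linearZ.
under eq_bigr => i _ do rewrite (lin_sum f) (lin_sum g) big_distrlr /=.
rewrite exchange_big; apply: eq_bigr => j _; rewrite exchange_big.
have delta_mul i (A : 'M[R]_n.+1) l : (delta_mx 0 i *m A : V) 0 l = A i l.
  by have /rowP/(_ l) := rowE i A; rewrite [row _ _ _ _]mxE => ->.
have E l : \sum_i (delta_mx 0 i *m P : V) 0 j * f (delta_mx 0 j) *
    ((delta_mx 0 i *m invmx P^T : V) 0 l * g (delta_mx 0 l)) =
    (j == l)%:R * (f (delta_mx 0 j) * g (delta_mx 0 l)).
  have := congr1 (fun A : 'M[R]_n.+1 => A j l)
    (mulmxV (etrans (unitmx_tr P) uP)).
  rewrite [X in X = _]mxE [X in _ = X]mxE => <-; rewrite mulr_suml.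
  apply: eq_bigr => i _.
  by rewrite !delta_mul [P^T _ _]mxE mulrACA.
under eq_bigr => l _ do rewrite E.
rewrite (bigD1 j) //= eqxx mul1r big1 ?addr0 // => l.
by rewrite eq_sym => /negbTE ->; rewrite mul0r.
Qed.

(** Positions transform by P and momenta by k^-1 times the inverse transpose. By [sum_dual_basis]
    the two matrices cancel in the bracket and only k^-1 is left. *)
Lemma poisson_bracket_T F G q v :
  differentiable F (T (q, v)) -> differentiable G (T (q, v)) ->
  poisson_bracket (metric M) (F \o T) (G \o T) (q, v) =
  k^-1 * poisson_bracket (metric N) F G (T (q, v)).
Proof.
move=> dF dG; rewrite /T {2}/phase_map !poisson_bracketE ?metric_M_unit //.
rewrite -/T.
set y := T (q, v); rewrite -[(affine _ _ _, _)]/y.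
have lp : linear (fun u : V => (u, 0) : V * V).
  by move=> c u w; rewrite /GRing.scale /= -[RHS]/(_ + _, _ + _) /= scaler0 addr0.
have lv : linear (fun u : V => (0, u *m invmx (metric N)) : V * V).
  move=> c u w; rewrite mulmxDl -scalemxAl.
  by rewrite /GRing.scale /= -[RHS]/(_ + _, _ + _) /= scaler0 addr0.
have [Fp FpE] := derive_linear lp dF; have [Fv FvE] := derive_linear lv dF.
have [Gp GpE] := derive_linear lp dG; have [Gv GvE] := derive_linear lv dG.
have bracketE (f g f' g' : {linear V -> R}) :
    \sum_i (f (delta_mx 0 i *m P) * (k^-1 * g (delta_mx 0 i *m invmx P^T))
      - (k^-1 * f' (delta_mx 0 i *m invmx P^T)) * g' (delta_mx 0 i *m P)) =
    k^-1 * \sum_i (f (delta_mx 0 i) * g (delta_mx 0 i)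
      - f' (delta_mx 0 i) * g' (delta_mx 0 i)).
  under eq_bigr => i _ do rewrite mulrCA -mulrA [_ * g' _]mulrC -mulrBr.
  rewrite -mulr_sumr !sumrB !sum_dual_basis; congr (_ * (_ - _)).
  by apply: eq_bigr => i _; rewrite mulrC.
have Tp H (Hp : {linear V -> R}) u : (forall u, 'D_(u, 0) H y = Hp u) ->
    'D_(u, 0) (H \o T) (q, v) = Hp (u *m P).
  by move=> HpE; rewrite derive_T /L [(_, _).1]/= [(_, _).2]/= mul0mx HpE.
have Tv H (Hv : {linear V -> R}) u :
    (forall u, 'D_(0, u *m invmx (metric N)) H y = Hv u) ->
    'D_(0, u *m invmx (metric M)) (H \o T) (q, v) = k^-1 * Hv (u *m invmx P^T).
  move=> HvE; rewrite derive_T /L [(_, _).1]/= [(_, _).2]/= mul0mx invmx_metric.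
  by rewrite scalemxAl HvE linearZ.
transitivity (\sum_i
    (Fp (delta_mx 0 i *m P) * (k^-1 * Gv (delta_mx 0 i *m invmx P^T))
      - (k^-1 * Fv (delta_mx 0 i *m invmx P^T)) * Gp (delta_mx 0 i *m P))).
  apply: eq_bigr => i _.
  by rewrite (Tp F Fp) // (Tp G Gp) // (Tv F Fv) // (Tv G Gv).
rewrite bracketE; congr (_ * _); apply: eq_bigr => i _.
by rewrite FpE FvE GpE GvE.
Qed.

Lemma reflection_invariant_T (B : set V) F :
  reflection_invariant N B F ->
  reflection_invariant M (affine P z @^-1` B) (F \o T).
Proof.
move=> HF q v v' Bq nS [t [m [tt nm -> ->]]].
rewrite /= /T /phase_map /= mulmxDl mulmxBl; apply: HF => //; first by move/singularE.
exists (t *m P), (m *m P); split=> //; first exact: tangent_affine.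
move=> w tw; apply: (mulfI k0); rewrite mulr0 -[w](mulmxKV uP) -mdot_metric.
(* B is the preimage of the wall of M under the inverse map, so w P^-1 is tangent to the wall of M
   and can be tested against m. *)
apply: nm; rewrite -(affineK z uP q); apply: tangent_affine.
rewrite (_ : _ @^-1` _ = B) //; apply/seteqP.
by split=> x; rewrite /preimage /= (affineVK z uP).
Qed.

(** Conservation enters in its infinitesimal form, which transfers by the chain rule without
    transporting motions. *)
Lemma integrable_T (wM wN : set (set V)) F :
  (forall i, conserved N (F i)) -> integrable_by N wN F ->
  (forall B, wM B -> exists2 B', wN B' & B = affine P z @^-1` B') ->
  integrable_by M wM (fun i => F i \o T).
Proof.
move=> cF [iF indF invF refF] HB; split.
- by move=> i; apply: first_integral_T => //; have [] := iF i.
- by apply: independent_T => // i; have [] := iF i.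
- move=> i j [q v] /phase_T ps.
  have d l : differentiable (F l) (T (q, v)) by apply: ((iF l).1 1%N).1.
  by rewrite poisson_bracket_T // invF // mulr0.
- by move=> i B /HB[B' B'N ->]; apply: reflection_invariant_T; exact: refF.
Qed.

End Transfer.

(** * The normalized Lagrange problem *)

Section Coordinates.
Variable R : realType.
Implicit Types q u v : 'rV[R]_3.

Lemma cx_vec3 (x y z : R) : cx (vec3 x y z) = x.
Proof. by rewrite /cx mxE inordK. Qed.

Lemma cy_vec3 (x y z : R) : cy (vec3 x y z) = y.
Proof. by rewrite /cy mxE inordK. Qed.

Lemma cz_vec3 (x y z : R) : cz (vec3 x y z) = z.
Proof. by rewrite /cz mxE inordK. Qed.

Lemma vec3K q : vec3 (cx q) (cy q) (cz q) = q.
Proof.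
apply/rowP => i; rewrite mxE /cx /cy /cz.
by case: i => -[|[|[|//]]] li /=; congr (q _ _); apply/val_inj; rewrite /= inordK.
Qed.

Lemma vec3_eq u v : cx u = cx v -> cy u = cy v -> cz u = cz v -> u = v.
Proof. by move=> ex ey ez; rewrite -(vec3K u) -(vec3K v) ex ey ez. Qed.

Lemma cxD u v : cx (u + v) = cx u + cx v. Proof. by rewrite /cx mxE. Qed.
Lemma cyD u v : cy (u + v) = cy u + cy v. Proof. by rewrite /cy mxE. Qed.
Lemma czD u v : cz (u + v) = cz u + cz v. Proof. by rewrite /cz mxE. Qed.
Lemma cxN u : cx (- u) = - cx u. Proof. by rewrite /cx mxE. Qed.
Lemma cyN u : cy (- u) = - cy u. Proof. by rewrite /cy mxE. Qed.
Lemma czN u : cz (- u) = - cz u. Proof. by rewrite /cz mxE. Qed.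
Lemma cxZ (c : R) u : cx (c *: u) = c * cx u. Proof. by rewrite /cx mxE. Qed.
Lemma cyZ (c : R) u : cy (c *: u) = c * cy u. Proof. by rewrite /cy mxE. Qed.
Lemma czZ (c : R) u : cz (c *: u) = c * cz u. Proof. by rewrite /cz mxE. Qed.

Lemma cx0 : cx (0 : 'rV[R]_3) = 0. Proof. by rewrite /cx mxE. Qed.
Lemma cy0 : cy (0 : 'rV[R]_3) = 0. Proof. by rewrite /cy mxE. Qed.
Lemma cz0 : cz (0 : 'rV[R]_3) = 0. Proof. by rewrite /cz mxE. Qed.

Definition cE := (cx0, cy0, cz0, cxD, cyD, czD, cxN, cyN, czN, cxZ, cyZ, czZ,
                  cx_vec3, cy_vec3, cz_vec3).

Lemma sum_ord3 (F : 'I_3 -> R) :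
  \sum_i F i = F (inord 0) + F (inord 1) + F (inord 2).
Proof.
rewrite !big_ord_recr big_ord0 /= add0r.
by congr (F _ + F _ + F _); apply/val_inj; rewrite /= inordK.
Qed.

Lemma delta_vec3 :
  (delta_mx 0 (inord 0) = vec3 1 0 0 :> 'rV[R]_3) *
  (delta_mx 0 (inord 1) = vec3 0 1 0 :> 'rV[R]_3) *
  (delta_mx 0 (inord 2) = vec3 0 0 1 :> 'rV[R]_3).
Proof.
by do ![split]; apply/rowP => i; rewrite !mxE eqxx /= -val_eqE /= inordK //;
  case: i => -[|[|[|//]]].
Qed.

Lemma mdot_W (a : R) u v :
  mdot (metric_W a) u v = cx u * cx v / (1 + a ^+ 2) + cy u * cy v + cz u * cz v.
Proof.
rewrite /mdot /metric_W mul_mx_diag mxE sum_ord3 !mxE !inordK //= !mulr1.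
by rewrite mulrAC.
Qed.

Lemma add1sqr_neq0 (a : R) : 1 + a ^+ 2 != 0.
Proof. by rewrite gt_eqF// ltr_pwDl// sqr_ge0. Qed.

Lemma metric_W_unit (a : R) : metric_W a \in unitmx.
Proof.
rewrite unitmxE det_diag !big_ord_recr big_ord0 /= !mxE /= mul1r !mulr1.
by rewrite unitfE invr_eq0 add1sqr_neq0.
Qed.

Lemma mul_invmx_metric_W (a : R) u :
  u *m invmx (metric_W a) = vec3 ((1 + a ^+ 2) * cx u) (cy u) (cz u).
Proof.
suff E : u = vec3 ((1 + a ^+ 2) * cx u) (cy u) (cz u) *m metric_W a.
  by rewrite {1}E mulmxK ?metric_W_unit.
apply: vec3_eq.
all: rewrite /metric_W mul_mx_diag ?cE; rewrite /cx /cy /cz !mxE !inordK //=.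
- by rewrite mulrAC mulfV ?mul1r // add1sqr_neq0.
- by rewrite mulr1.
- by rewrite mulr1.
Qed.

(** The inverse Gram matrix is diag(1 + a^2, 1, 1), so only the x direction of the velocity
    derivatives is rescaled. *)
Lemma poisson_bracket_W (a : R) (F G : 'rV[R]_3 * 'rV[R]_3 -> R) q v :
  let ex := vec3 1 0 0 in let ey := vec3 0 1 0 in let ez := vec3 0 0 1 in
  let ex' := vec3 (1 + a ^+ 2) 0 0 in
  poisson_bracket (metric_W a) F G (q, v) =
    ('D_(ex, 0) F (q, v) * 'D_(0, ex') G (q, v)
     - 'D_(0, ex') F (q, v) * 'D_(ex, 0) G (q, v))
  + ('D_(ey, 0) F (q, v) * 'D_(0, ey) G (q, v)
     - 'D_(0, ey) F (q, v) * 'D_(ey, 0) G (q, v))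
  + ('D_(ez, 0) F (q, v) * 'D_(0, ez) G (q, v)
     - 'D_(0, ez) F (q, v) * 'D_(ez, 0) G (q, v)).
Proof.
by rewrite poisson_bracketE ?metric_W_unit // sum_ord3 !mul_invmx_metric_W
  !delta_vec3 !cE !(mulr0, mulr1).
Qed.

End Coordinates.

(** * The three integrals as expressions, and their brackets *)

Section Model.
Variables (R : realType) (a m1 m2 f : R).

Notation phase := ('rV[R]_3 * 'rV[R]_3)%type.
Notation expr := (expr R 2).
Notation pX := (Pos R (inord 0 : 'I_3)).
Notation pY := (Pos R (inord 1 : 'I_3)).
Notation pZ := (Pos R (inord 2 : 'I_3)).
Notation vX := (Vel R (inord 0 : 'I_3)).
Notation vY := (Vel R (inord 1 : 'I_3)).
Notation vZ := (Vel R (inord 2 : 'I_3)).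
Notation C := (@Cst R 2).
Notation sq e := (Mul e e).
Notation Add3 e1 e2 e3 := (Add (Add e1 e2) e3).
Notation Sub e1 e2 := (Add e1 (Mul (C (-1)) e2)).

Notation dist2_expr b :=
  (Add3 (Mul (C (1 + a ^+ 2)^-1) (sq (Add pX (C (- b))))) (sq pY) (sq pZ)).

Definition force_expr : expr :=
  Add3 (Over m1 1 (dist2_expr a)) (Over m2 1 (dist2_expr (- a)))
       (Mul (C f) (dist2_expr 0)).

Definition E_sp_expr : expr :=
  Sub (Mul (C 2^-1) (Add3 (Mul (C (1 + a ^+ 2)^-1) (sq vX)) (sq vY) (sq vZ)))
      force_expr.

Definition E_sph_expr : expr :=
  Sub (Mul (C 2^-1)
        (Add (Add3 (sq vX) (sq vY) (sq vZ))
             (Add3 (sq (Sub (Mul pX vY) (Mul pY vX)))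
                   (sq (Sub (Mul pY vZ) (Mul pZ vY)))
                   (sq (Sub (Mul pZ vX) (Mul pX vZ))))))
      (Add3 (Mul (Over m1 1 (dist2_expr a)) (Add (C 1) (Mul (C a) pX)))
            (Mul (Over m2 1 (dist2_expr (- a))) (Add (C 1) (Mul (C (- a)) pX)))
            (Mul (C f) (Add3 (sq pX) (sq pY) (sq pZ)))).

Definition L_yz_expr : expr := Sub (Mul pY vZ) (Mul pZ vY).

Lemma mdist_W (p q : 'rV[R]_3) :
  mdist (metric_W a) p q = Num.sqrt ((1 + a ^+ 2)^-1 * (cx p - cx q) ^+ 2
    + (cy p - cy q) ^+ 2 + (cz p - cz q) ^+ 2).
Proof. by rewrite /mdist mnorm_W !cE [_ * (_ ^+ 2)]mulrC. Qed.

Lemma addr_sqr_ge0 (x y z : R) :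
  0 <= (1 + a ^+ 2)^-1 * x ^+ 2 + y ^+ 2 + z ^+ 2.
Proof.
by rewrite !addr_ge0 ?sqr_ge0 // mulr_ge0 ?sqr_ge0 // invr_ge0 addr_ge0 ?sqr_ge0.
Qed.

Let M := lagrange_system (metric_W a) (vec3 a 0 0) (vec3 (- a) 0 0)
  (vec3 0 0 0) m1 m2 f.

Lemma force_funE (q v : 'rV[R]_3) : force_fun M q = eval force_expr (q, v).
Proof.
rewrite /= /kepler_force /hooke_force !mdist_W sqr_sqrtr ?addr_sqr_ge0 // !cE.
by rewrite !(subr0, oppr0, addr0, expr1) -?expr2.
Qed.

Lemma E_spE : E_sp a m1 m2 f = eval E_sp_expr.
Proof.
apply/funext => -[q v]; rewrite /= -[X in - 1 * X](force_funE q v) mulN1r.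
rewrite /E_sp mnorm_W sqr_sqrtr; last by rewrite mulrC addr_sqr_ge0.
rewrite /= /kepler_force /hooke_force -!expr2.
by rewrite !opprD !addrA [_ / (1 + _)]mulrC.
Qed.

(** The root in [E_sph] is sqrt(1 + a^2) times the distance to the centre, which cancels the factor
    sqrt(1 + a^2) of the masses there. *)
Lemma sqrt_scale (b x y z : R) :
  Num.sqrt ((x - b) ^+ 2 + (1 + a ^+ 2) * (y ^+ 2 + z ^+ 2)) =
  Num.sqrt (1 + a ^+ 2)
  * Num.sqrt ((1 + a ^+ 2)^-1 * (x - b) ^+ 2 + y ^+ 2 + z ^+ 2).
Proof.
rewrite -sqrtrM ?addr_ge0 ?sqr_ge0 //; congr (Num.sqrt _).
by field; exact: add1sqr_neq0.
Qed.

Lemma E_sphE : E_sph a m1 m2 f = eval E_sph_expr.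
Proof.
apply/funext => -[q v]; rewrite /E_sph /=.
have := sqrt_scale (- a) (cx q) (cy q) (cz q); rewrite opprK => ->.
rewrite sqrt_scale.
have s0 : Num.sqrt (1 + a ^+ 2) != 0.
  by rewrite gt_eqF // sqrtr_gt0 ltr_pwDl // sqr_ge0.
rewrite -!/(cx _) -!/(cy _) -!/(cz _) !expr1 ?opprK -!expr2 !invfM.
move: (Num.sqrt (_ * (cx q - a) ^+ 2 + _ + _))^-1
  (Num.sqrt (_ * (cx q + a) ^+ 2 + _ + _))^-1 => r1 r2.
by field.
Qed.

Lemma L_yzE : @L_yz R = eval L_yz_expr.
Proof. by apply/funext => -[q v]; rewrite /L_yz /= mulN1r. Qed.

(** These are the side conditions that [wd] imposes on the two [Over] terms. *)
Lemma singular_set_W (q : 'rV[R]_3) : ~ singular_set M q ->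
  (m1 != 0 -> 0 < (1 + a ^+ 2)^-1 * (cx q - a) ^+ 2 + cy q ^+ 2 + cz q ^+ 2) /\
  (m2 != 0 -> 0 < (1 + a ^+ 2)^-1 * (cx q + a) ^+ 2 + cy q ^+ 2 + cz q ^+ 2).
Proof.
have H b : q <> vec3 b 0 0 ->
    0 < (1 + a ^+ 2)^-1 * (cx q - b) ^+ 2 + cy q ^+ 2 + cz q ^+ 2.
  move=> qb; rewrite lt_def addr_sqr_ge0 andbT; apply/eqP => e; apply: qb.
  have k0 : 0 < (1 + a ^+ 2)^-1 by rewrite invr_gt0 ltr_pwDl ?sqr_ge0.
  have kx : 0 <= (1 + a ^+ 2)^-1 * (cx q - b) ^+ 2.
    by apply: mulr_ge0; [exact: ltW|exact: sqr_ge0].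
  move/eqP: e; rewrite paddr_eq0 ?sqr_ge0 //; last by rewrite addr_ge0 ?sqr_ge0.
  rewrite paddr_eq0 ?sqr_ge0 // mulrI_eq0; last exact/lregP/lt0r_neq0.
  rewrite !sqrf_eq0 subr_eq0 => /andP[/andP[/eqP qx /eqP qy] /eqP qz].
  by rewrite -(vec3K q) qx qy qz.
move=> nS; split=> m0; first by apply: H => qa; apply: nS; left.
by have := H (- a); rewrite opprK; apply=> qa; apply: nS; right.
Qed.

Lemma wd_integrals (s : phase) : phase_space M s ->
  [/\ wd force_expr s, wd E_sp_expr s, wd E_sph_expr s & wd L_yz_expr s].
Proof.
move=> /singular_set_W[h1 h2].
by split; rewrite /= ?opprK -?expr2; do ?split.
Qed.

Lemma open_phase_space : open (phase_space M).
Proof.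
have c1 (Z : 'rV[R]_3) (m : R) : closed (kepler_singular Z m).
  have [m0|m0] := eqVneq m 0.
    rewrite (_ : kepler_singular _ _ = set0); first exact: closed0.
    by apply/seteqP; split=> x //= []; rewrite m0 eqxx.
  rewrite (_ : kepler_singular _ _ = [set Z]); last first.
    by apply/seteqP; split=> x // [].
  exact/accessible_closed_set1/hausdorff_accessible/norm_hausdorff.
rewrite (_ : phase_space M = fst @^-1` (~` singular_set M)) //.
apply: open_comp; first by move=> x _; exact: cvg_fst.
by apply: closed_openC; apply: closedU.
Qed.

(* On the phase space m / d = (m / d^3) d^2 even when m = 0 and d = 0. *)
Lemma over_cube (m t : R) : (m != 0 -> 0 < t) ->
  m / Num.sqrt t = m / Num.sqrt t ^+ 3 * t.
Proof.
have [->|m0 /(_ isT) t0] := eqVneq m 0; first by rewrite !mul0r.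
rewrite -[X in _ = _ * X](sqr_sqrtr (ltW t0)).
by field; rewrite gt_eqF // sqrtr_gt0.
Qed.

(** Differentiates symbolically and rewrites m / d as (m / d^3) d^2. The inverse cubes of the two
    distances are then the only irrational terms; generalized to r1 and r2, they leave a rational
    identity for [field]. *)
Ltac expand_brackets h1 h2 :=
  rewrite poisson_bracket_W; cbv zeta; rewrite !derive_eval //=;
  rewrite -!/(cx _) -!/(cy _) -!/(cz _) ?cE ?opprK -?expr2 ?expr1;
  rewrite ?(over_cube h1) ?(over_cube h2);
  move: (Num.sqrt (_ * (_ - a) ^+ 2 + _ + _) ^+ 3)^-1
        (Num.sqrt (_ * (_ + a) ^+ 2 + _ + _) ^+ 3)^-1 (add1sqr_neq0 a) => r1 r2 a0.

Lemma bracket_E_sp_E_sph q v : ~ singular_set M q ->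
  poisson_bracket (metric_W a) (eval E_sp_expr) (eval E_sph_expr) (q, v) = 0.
Proof.
move=> nS; have [h1 h2] := singular_set_W nS.
have [_ w1 w2 w3] := @wd_integrals (q, v) nS.
expand_brackets h1 h2.
by field.
Qed.

Lemma bracket_L_yz q v : ~ singular_set M q ->
  poisson_bracket (metric_W a) (eval E_sp_expr) (eval L_yz_expr) (q, v) = 0 /\
  poisson_bracket (metric_W a) (eval E_sph_expr) (eval L_yz_expr) (q, v) = 0.
Proof.
move=> nS; have [h1 h2] := singular_set_W nS.
have [_ w1 w2 w3] := @wd_integrals (q, v) nS.
split; expand_brackets h1 h2.
by field.
by field.
Qed.

End Model.

(** * Conservation along motions and involution *)

Section FirstIntegrals.
Variables (R : realType) (a m1 m2 f : R).
Notation force_expr := (force_expr a m1 m2 f).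
Notation E_sp_expr := (E_sp_expr a m1 m2 f).
Notation E_sph_expr := (E_sph_expr a m1 m2 f).
Notation L_yz_expr := (L_yz_expr R).

Let M := lagrange_system (metric_W a) (vec3 a 0 0) (vec3 (- a) 0 0)
  (vec3 0 0 0) m1 m2 f.

(** The force function depends on the position only; placing it at velocity 0 lets the calculus of
    phase-space expressions apply. *)
Let embed (q : 'rV[R]_3) : 'rV[R]_3 * 'rV[R]_3 := (q, 0).

Let force_fun_comp : force_fun M = eval force_expr \o embed.
Proof. by apply/funext => q; exact: force_funE. Qed.

Lemma differentiable_force q : ~ singular_set M q ->
  differentiable (force_fun M) q.
Proof.
move=> nS; rewrite force_fun_comp; apply: differentiable_comp.
  exact: differentiable_pair.
by have [/is_diff_eval[]] := @wd_integrals _ a m1 m2 f (embed q) nS.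
Qed.

Lemma derive_force q u : ~ singular_set M q ->
  'D_u (force_fun M) q = eval (deriv_expr (u, 0) force_expr) (q, 0).
Proof.
move=> nS; rewrite force_fun_comp (@derive_comp_affine _ _ _ _ _ _ embed).
  by rewrite derive_eval //; have [] := @wd_integrals _ a m1 m2 f (embed q) nS.
by move=> h w x; rewrite /embed; congr (_, _); rewrite /= scaler0 addr0.
Qed.

Lemma derive_along_force q v w : ~ singular_set M q ->
  (forall u, mdot (metric_W a) w u = 'D_u (force_fun M) q) ->
  [/\ 'D_(v, w) (eval E_sp_expr) (q, v) = 0,
      'D_(v, w) (eval E_sph_expr) (q, v) = 0 &
      'D_(v, w) (eval L_yz_expr) (q, v) = 0].
Proof.
move=> nS eqm; have [h1 h2] := singular_set_W nS.
have [_ w1 w2 w3] := @wd_integrals _ a m1 m2 f (q, v) nS.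
have a0 := add1sqr_neq0 a.
(* Testing the equation of motion on the basis vectors yields the three coordinates of the
   acceleration w. *)
have := eqm (vec3 1 0 0); have := eqm (vec3 0 1 0); have := eqm (vec3 0 0 1).
rewrite !derive_eval // !derive_force // !mdot_W /=.
rewrite -!/(cx _) -!/(cy _) -!/(cz _) ?cE ?opprK -?expr2 ?expr1.
rewrite ?(over_cube h1) ?(over_cube h2).
move: (Num.sqrt (_ * (_ - a) ^+ 2 + _ + _) ^+ 3)^-1
      (Num.sqrt (_ * (_ + a) ^+ 2 + _ + _) ^+ 3)^-1 => r1 r2.
rewrite !(mulr0, mul0r, add0r, addr0, mulr1) => ez ey ex.
(* The x equation carries the metric factor (1 + a^2)^-1, which is moved to the other side. *)
have {}ex := canRL (mulfVK a0) ex.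
rewrite ex ey ez; split; by field.
Qed.

Definition integral_expr : 'I_3 -> expr R 2 :=
  tnth [tuple E_sp_expr; E_sph_expr; L_yz_expr].

Lemma integralE i :
  tnth [tuple E_sp a m1 m2 f; E_sph a m1 m2 f; @L_yz R] i = eval (integral_expr i).
Proof.
rewrite /integral_expr !(tnth_nth (E_sp a m1 m2 f)) !(tnth_nth E_sp_expr).
by case: i => -[|[|[|//]]] li /=; rewrite (E_spE, E_sphE, L_yzE).
Qed.

Lemma integral_expr_ind (P : expr R 2 -> Prop) :
  P E_sp_expr -> P E_sph_expr -> P L_yz_expr -> forall i, P (integral_expr i).
Proof.
move=> P1 P2 P3 i; rewrite /integral_expr (tnth_nth E_sp_expr).
by case: i => -[|[|[|//]]].
Qed.

Lemma conserved_W i : conserved M (eval (integral_expr i)).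
Proof.
move=> q v w nS eqm; have [] := derive_along_force v nS eqm => *.
exact: (integral_expr_ind (P := fun e => 'D_(v, w) (eval e) (q, v) = 0)).
Qed.

Lemma first_integral_W i : first_integral M (eval (integral_expr i)).
Proof.
apply: first_integral_of_conserved.
- apply: smooth_eval; first exact: open_phase_space.
  move=> s ps; have [] := wd_integrals ps => *.
  exact: (integral_expr_ind (P := fun e => wd e s)).
- exact: differentiable_force.
- exact: conserved_W.
Qed.

Lemma involution_W i j s : phase_space M s ->
  poisson_bracket (metric_W a) (eval (integral_expr i)) (eval (integral_expr j)) s = 0.
Proof.
case: s => q v nS; have B12 := bracket_E_sp_E_sph v nS.
have [B13 B23] := bracket_L_yz v nS.
pose pb e e' := poisson_bracket (metric_W a) (eval e) (eval e') (q, v).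
apply: (integral_expr_ind (P := fun e => pb e (integral_expr j) = 0));
  apply: (integral_expr_ind (P := fun e' => pb _ e' = 0));
  rewrite /pb ?poisson_bracket_self //;
  by rewrite poisson_bracket_anti ?(B12, B13, B23) oppr0.
Qed.

End FirstIntegrals.

(** * Functional independence *)

(** Write p = q (X - x)^m with q(x) != 0: the first factor is nonzero near x by continuity, the
    second away from x. *)
Lemma near_horner_neq0 (R : realType) (p : {poly R}) (x : R) :
  p != 0 -> \forall t \near x^', p.[t] != 0.
Proof.
move=> p0; have [m [q rq ->]] := multiplicity_XsubC p x.
move: rq; rewrite p0 /= => rq.
have qx : \forall t \near x, q.[t] != 0.
  have /= := @continuous_horner R q x.
  by move=> /cvgr_neq0; apply; move: rq; rewrite rootE.
near=> t; rewrite hornerM mulf_eq0 negb_or; apply/andP; split.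
  by near: t; exact: nbhs_dnbhs.
rewrite horner_exp expf_eq0 negb_and hornerXsubC subr_eq0; apply/orP; right.
near: t; exact: nbhs_dnbhs_neq.
Unshelve. all: by end_near. Qed.

Section PolynomialExpressions.
Variables (R : realType) (n : nat).
Notation phase := ('rV[R]_n.+1 * 'rV[R]_n.+1)%type.

Fixpoint polynomial_expr (e : expr R n) : bool :=
  match e with
  | Over _ _ _ => false
  | Add e1 e2 | Mul e1 e2 => polynomial_expr e1 && polynomial_expr e2
  | _ => true
  end.

Lemma wd_polynomial_expr e (s : phase) : polynomial_expr e -> wd e s.
Proof. by elim: e => //= e1 IH1 e2 IH2 /andP[/IH1 ? /IH2 ?]. Qed.

Lemma continuous_polynomial_expr e : polynomial_expr e -> continuous (eval e).
Proof.
move=> pe s; apply: differentiable_continuous.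
by have [] := is_diff_eval (wd_polynomial_expr s pe).
Qed.

Lemma polynomial_expr_on_line e (s d : phase) : polynomial_expr e ->
  exists p : {poly R}, forall t, eval e (t *: d + s) = p.[t].
Proof.
elim: e => //=.
- by move=> i _; exists ((d.1 0 i)%:P * 'X + (s.1 0 i)%:P) => t;
    rewrite !hornerE !mxE mulrC.
- by move=> i _; exists ((d.2 0 i)%:P * 'X + (s.2 0 i)%:P) => t;
    rewrite !hornerE !mxE mulrC.
- by move=> c _; exists c%:P => t; rewrite hornerC.
- move=> e1 IH1 e2 IH2 /andP[/IH1[p1 h1] /IH2[p2 h2]].
  by exists (p1 + p2) => t; rewrite hornerD h1 h2.
- move=> e1 IH1 e2 IH2 /andP[/IH1[p1 h1] /IH2[p2 h2]].
  by exists (p1 * p2) => t; rewrite hornerM h1 h2.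
Qed.

(** On the line through s (at t = 0) and s0 (at t = 1) the expression is a polynomial in t, nonzero
    at t = 1, hence nonzero at arbitrarily small t. *)
Lemma dense_polynomial_expr e (s0 : phase) : polynomial_expr e ->
  eval e s0 != 0 ->
  forall (s : phase) (B : set phase), nbhs s B -> exists s', B s' /\ eval e s' != 0.
Proof.
move=> pe e0 s B Bs; have [p hp] := polynomial_expr_on_line s (s0 - s) pe.
have p0 : p != 0.
  apply: contraNneq e0 => p0; have := hp 1.
  by rewrite scale1r subrK p0 horner0 => ->.
have cB : \forall t \near (0 : R)^', B (t *: (s0 - s) + s).
  apply: nbhs_dnbhs; have : nbhs (0 *: (s0 - s) + s) B.
    by rewrite scale0r add0r.
  apply: (_ : {for 0, continuous (fun t : R => t *: (s0 - s) + s)}).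
  by apply: continuousD; [exact: scalel_continuous|exact: cst_continuous].
have [t [Bt pt]] := filter_ex (filterI cB (near_horner_neq0 0 p0)).
by exists (t *: (s0 - s) + s); rewrite hp.
Qed.

End PolynomialExpressions.

Section Independence.
Variables (R : realType) (a m1 m2 f : R).
Notation pX := (Pos R (inord 0 : 'I_3)).
Notation pY := (Pos R (inord 1 : 'I_3)).
Notation pZ := (Pos R (inord 2 : 'I_3)).
Notation vX := (Vel R (inord 0 : 'I_3)).
Notation vY := (Vel R (inord 1 : 'I_3)).
Notation vZ := (Vel R (inord 2 : 'I_3)).
Notation C := (@Cst R 2).
Notation Sub e1 e2 := (Add e1 (Mul (C (-1)) e2)).

(* The determinant of the velocity gradients of the three integrals. *)
Definition gradient_det : expr R 2 :=
  let l1 := Sub (Mul pY vZ) (Mul pZ vY) in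
  let l2 := Sub (Mul pZ vX) (Mul pX vZ) in
  let l3 := Sub (Mul pX vY) (Mul pY vX) in
  let b1 := Add vX (Sub (Mul pZ l2) (Mul pY l3)) in
  let b2 := Add vY (Sub (Mul pX l3) (Mul pZ l1)) in
  let b3 := Add vZ (Sub (Mul pY l1) (Mul pX l2)) in
  Sub (Mul (Mul (C (1 + a ^+ 2)^-1) vX) (Add (Mul b2 pY) (Mul b3 pZ)))
      (Mul b1 (Add (Mul vY pY) (Mul vZ pZ))).

Let M := lagrange_system (metric_W a) (vec3 a 0 0) (vec3 (- a) 0 0)
  (vec3 0 0 0) m1 m2 f.

(** Velocity directions suffice: they give a 3 by 3 linear system for the coefficients, whose
    determinant is [gradient_det]. *)
Lemma independent_gradients s (c : 'I_3 -> R) : phase_space M s ->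
  eval gradient_det s != 0 ->
  (forall w, \sum_i c i * 'd (eval (integral_expr a m1 m2 f i)) s w = 0) ->
  forall i, c i = 0.
Proof.
move=> ps d0 H.
have wdi i : wd (integral_expr a m1 m2 f i) s.
  have [] := wd_integrals ps => *.
  exact: (integral_expr_ind (P := fun e => wd e s)).
have {}H w : \sum_i c i * eval (deriv_expr w (integral_expr a m1 m2 f i)) s = 0.
  rewrite -[RHS](H w); apply: eq_bigr => i _; congr (_ * _).
  by have [_ ->] := is_diff_eval (wdi i).
suff [c0 c1 c2] : [/\ c (inord 0) = 0, c (inord 1) = 0 & c (inord 2) = 0].
  move=> i; have -> : i = inord i by apply/val_inj; rewrite /= inordK.
  by case: i => -[|[|[|//]]] li.
have := H (0, vec3 0 0 1); have := H (0, vec3 0 1 0); have := H (0, vec3 1 0 0).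
rewrite !sum_ord3 /integral_expr !(tnth_nth (C 0)) !inordK //=.
move: d0 => /=; rewrite -!/(cx _) -!/(cy _) -!/(cz _) ?cE -?expr2.
rewrite !(mulr0, mul0r, add0r, addr0, mulr1, mulN1r, oppr0).
move: (cx s.1) (cy s.1) (cz s.1) (cx s.2) (cy s.2) (cz s.2) => x y z vx vy vz.
move: (c (inord 0)) (c (inord 1)) (c (inord 2)) (1 + a ^+ 2)^-1 => c0 c1 c2 k.
set b2 := _ + (_ - _); set b3 := _ + (_ - _); set b1 := _ + (_ - _).
move=> d0 H1 H2 H3.
have {}H1 : c0 * (k * vx) + c1 * b1 = 0 by rewrite -H1 /b1; field.
have {}H2 : c0 * vy + c1 * b2 - c2 * z = 0 by rewrite -H2 /b2; field.
have {}H3 : c0 * vz + c1 * b3 + c2 * y = 0 by rewrite -H3 /b3; field.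
move: b1 b2 b3 d0 H1 H2 H3 => b1 b2 b3 d0 H1 H2 H3.
(* The combination of y times [H2] and z times [H3] is free of c2. With [H1] it forms a 2 by 2
   system in c0 and c1, solved by Cramer's rule. *)
have e0 : c0 = 0.
  apply/(mulIf d0); rewrite mul0r.
  transitivity ((b2 * y + b3 * z) * (c0 * (k * vx) + c1 * b1)
    - b1 * (y * (c0 * vy + c1 * b2 - c2 * z) + z * (c0 * vz + c1 * b3 + c2 * y))).
    by ring.
  by rewrite H1 H2 H3; ring.
have e1 : c1 = 0.
  apply/(mulIf d0); rewrite mul0r.
  transitivity (k * vx * (y * (c0 * vy + c1 * b2 - c2 * z) +
      z * (c0 * vz + c1 * b3 + c2 * y))
    - (vy * y + vz * z) * (c0 * (k * vx) + c1 * b1)).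
    by ring.
  by rewrite H1 H2 H3; ring.
(* What remains is c2 z = c2 y = 0, and y = z = 0 would make the determinant vanish. *)
split=> //; move: H2 H3; rewrite e0 e1 !mul0r !add0r => /eqP + /eqP.
rewrite oppr_eq0 !mulf_eq0; have [//|c20 /= /eqP z0 /eqP y0] := eqVneq c2 0.
by move: d0; rewrite z0 y0 !(mulr0, addr0, subr0) eqxx.
Qed.

Lemma independent_W :
  functionally_independent M (fun i => eval (integral_expr a m1 m2 f i)).
Proof.
have pd : polynomial_expr gradient_det by [].
have oM : open (phase_space M) by exact: open_phase_space.
exists (phase_space M `&` [set s | eval gradient_det s != 0]); split.
- apply: openI => //.
  apply: (open_comp (f := eval gradient_det) (D := [set r : R | r != 0])).
    by move=> s _; exact: continuous_polynomial_expr.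
  exact: open_neq.
- by move=> s [].
- move=> s ps B Bs.
  (* At q = (0, 1, 0), v = (1, 1, 0) the determinant equals (1 + a^2)^-1 - 2, which is negative. *)
  have d0 : eval gradient_det (vec3 0 1 0, vec3 1 1 0) != 0.
    rewrite /= -!/(cx _) -!/(cy _) -!/(cz _) ?cE.
    have k1 : (1 + a ^+ 2)^-1 <= 1.
      by rewrite invf_le1 ?ltr_pwDl ?lerDl ?sqr_ge0.
    by rewrite lt_eqF //; nra.
  have [|s' [[Bs' ps'] d]] := dense_polynomial_expr pd d0
      (s := s) (B := B `&` phase_space M).
    by apply: filterI => //; exact: open_nbhs_nbhs.
  by exists s'.
- by move=> s [ps d] c; exact: independent_gradients.
Qed.

End Independence.

(** * Reflection at confocal quadrics *)

Section FocalDistances.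
Variable R : realType.

(* For both families of quadrics, multiplying by the conjugate factor makes the
   equation polynomial in the squared distances; the triangle inequality below
   tells the two factors apart. *)
Lemma focal_product (c k a x r d1 d2 : R) :
  d1 ^+ 2 = k * (x - a) ^+ 2 + r -> d2 ^+ 2 = k * (x + a) ^+ 2 + r ->
  (c ^+ 2 - (d1 + d2) ^+ 2) * (c ^+ 2 - (d1 - d2) ^+ 2) =
  c ^+ 2 * (c ^+ 2 - 4 * k * a ^+ 2) - 4 * k * x ^+ 2 * (c ^+ 2 - 4 * k * a ^+ 2)
  - 4 * c ^+ 2 * r.
Proof.
move=> e1 e2.
transitivity (c ^+ 4 - 2 * c ^+ 2 * (d1 ^+ 2 + d2 ^+ 2)
  + (d1 ^+ 2 - d2 ^+ 2) ^+ 2); first by ring.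
by rewrite e1 e2; ring.
Qed.

Lemma focal_triangle (k a x r d1 d2 : R) : 0 <= k -> 0 <= r -> 0 <= d1 -> 0 <= d2 ->
  d1 ^+ 2 = k * (x - a) ^+ 2 + r -> d2 ^+ 2 = k * (x + a) ^+ 2 + r ->
  (d1 - d2) ^+ 2 <= 4 * k * a ^+ 2 <= (d1 + d2) ^+ 2.
Proof.
move=> k0 r0 p1 p2 e1 e2.
(* X is the inner product of the vectors from the two foci to the point, and [XX] is the
   Cauchy-Schwarz inequality for it. *)
pose X := k * x ^+ 2 + r - k * a ^+ 2.
have XX : X ^+ 2 <= (d1 * d2) ^+ 2.
  rewrite -subr_ge0 exprMn e1 e2 /X.
  rewrite (_ : _ - _ = 4 * (k * a ^+ 2 * r)); last by ring.
  by do 3!apply: mulr_ge0 => //; exact: sqr_ge0.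
have : `|X| <= d1 * d2 by rewrite -ler_sqr ?nnegrE ?mulr_ge0 // real_normK ?num_real.
rewrite ler_norml => /andP[X1 X2].
by apply/andP; split; rewrite ?(sqrrB, sqrrD) e1 e2; move: X1 X2; rewrite /X; lra.
Qed.

Definition quadratic (s b : R) (u w : 'rV[R]_3) : R :=
  s * cx u * cx w + b * (cy u * cy w + cz u * cz w).

(* The relation between s and b says that the foci are (a, 0, 0), (-a, 0, 0);
   b < 0 for hyperboloids. *)
Lemma confocal_quadricE (a : R) (B : set 'rV[R]_3) : a != 0 ->
  confocal_quadric (metric_W a) (vec3 a 0 0) (vec3 (- a) 0 0) B ->
  exists s b, [/\ b != 0, b = s * (a ^+ 2 * b + 1 + a ^+ 2) &
    B = [set q | quadratic s b q q = 1]].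
Proof.
move=> a0; set k := (1 + a ^+ 2)^-1; set e := 4 * k * a ^+ 2.
have k0 : 0 < k by rewrite invr_gt0 ltr_pwDl ?sqr_ge0.
have e0 : 0 < e.
  by apply: mulr_gt0; [rewrite mulr_gt0|rewrite lt_def sqr_ge0 sqrf_eq0 a0].
(* Here e is the square of the distance between the foci. *)
have -> : confocal_quadric (metric_W a) (vec3 a 0 0) (vec3 (- a) 0 0) B =
    ((exists2 c, Num.sqrt e < c &
        B = spheroid (metric_W a) (vec3 a 0 0) (vec3 (- a) 0 0) c) \/
     (exists2 c, 0 < c < Num.sqrt e &
        B = hyperboloid (metric_W a) (vec3 a 0 0) (vec3 (- a) 0 0) c)).
  rewrite /confocal_quadric.
  have -> // : mdist (metric_W a) (vec3 a 0 0) (vec3 (- a) 0 0) = Num.sqrt e.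
  by rewrite mdist_W !cE; congr Num.sqrt; rewrite /e /k; field; exact: add1sqr_neq0.
(* Both families are treated together: c^2 > e gives spheroids, c^2 < e hyperboloids. *)
have main c : 0 < c -> c ^+ 2 != e -> exists s b,
    [/\ b != 0, b = s * (a ^+ 2 * b + 1 + a ^+ 2) & forall q,
      let d1 := mdist (metric_W a) q (vec3 a 0 0) in
      let d2 := mdist (metric_W a) q (vec3 (- a) 0 0) in
      [/\ 0 <= d1, 0 <= d2, (d1 - d2) ^+ 2 <= e <= (d1 + d2) ^+ 2 &
      quadratic s b q q = 1 <->
        c ^+ 2 = (d1 + d2) ^+ 2 \/ c ^+ 2 = (d1 - d2) ^+ 2]].
  move=> c0; rewrite -subr_eq0 => ce.
  have c20 : c ^+ 2 != 0 by rewrite sqrf_eq0 gt_eqF.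
  (* The coefficients are read off from [focal_product] after division by c^2 (c^2 - e). *)
  exists (4 * k / c ^+ 2), (4 / (c ^+ 2 - e)); split.
  - by rewrite mulf_neq0 // invr_eq0.
  - have E : c ^+ 2 = k * (4 * a ^+ 2 + (1 + a ^+ 2) * (c ^+ 2 - e)).
      by rewrite /e /k; field; exact: add1sqr_neq0.
    transitivity (4 / (c ^+ 2 * (c ^+ 2 - e))
      * (k * (4 * a ^+ 2 + (1 + a ^+ 2) * (c ^+ 2 - e)))).
      rewrite -E; move: (c ^+ 2 - e) (c ^+ 2) ce c20 => g C ? ?.
      by field; do ?[apply/andP; split].
    by move: (c ^+ 2 - e) (c ^+ 2) ce c20 => g C ? ?; field; do ?[apply/andP; split].
  - move=> q; cbv zeta; set d1 := mdist _ _ _; set d2 := mdist _ _ _.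
    have d1_ge0 : 0 <= d1 by exact: sqrtr_ge0.
    have d2_ge0 : 0 <= d2 by exact: sqrtr_ge0.
    set r := cy q ^+ 2 + cz q ^+ 2.
    have e1 : d1 ^+ 2 = k * (cx q - a) ^+ 2 + r.
      by rewrite /d1 mdist_W sqr_sqrtr ?addr_sqr_ge0 // !cE !subr0 -addrA.
    have e2 : d2 ^+ 2 = k * (cx q + a) ^+ 2 + r.
      by rewrite /d2 mdist_W sqr_sqrtr ?addr_sqr_ge0 // !cE !subr0 opprK -addrA.
    split=> //.
      apply: (focal_triangle (ltW k0) _ _ _ e1 e2) => //.
      by rewrite addr_ge0 ?sqr_ge0.
    have P := focal_product c e1 e2.
    have P' : (c ^+ 2 - (d1 + d2) ^+ 2) * (c ^+ 2 - (d1 - d2) ^+ 2) =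
      c ^+ 2 * (c ^+ 2 - e) * (1 - quadratic (4 * k / c ^+ 2) (4 / (c ^+ 2 - e)) q q).
      rewrite P -/e /quadratic /r.
      by move: (c ^+ 2 - e) (c ^+ 2) ce c20 => g C ? ?; field; do ?[apply/andP; split].
    split=> [q1|H].
      move: P'; rewrite q1 subrr mulr0 => /eqP; rewrite mulf_eq0 !subr_eq0.
      by case/orP => /eqP; [left|right].
    have : c ^+ 2 * (c ^+ 2 - e)
        * (1 - quadratic (4 * k / c ^+ 2) (4 / (c ^+ 2 - e)) q q) == 0.
      by rewrite -P'; case: H => ->; rewrite subrr ?mul0r ?mulr0.
    rewrite mulf_eq0 (mulf_eq0 (c ^+ 2)) (negbTE c20) (negbTE ce) subr_eq0 /=.
    by move=> /eqP.
have se : Num.sqrt e ^+ 2 = e by rewrite sqr_sqrtr // ltW.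
have s0 : 0 <= Num.sqrt e by exact: sqrtr_ge0.
case=> -[c].
  move=> ec ->; have c0 : 0 < c by exact: le_lt_trans ec.
  have ce : e < c ^+ 2 by rewrite -se ltr_sqr ?nnegrE // ltW.
  have [||s [b [b0 bs Q]]] := main c => //; first by rewrite gt_eqF.
  exists s, b; split=> //; apply/seteqP.
  split=> q; have /= [d1 d2 /andP[t1 t2] ->] := Q q.
    by rewrite /spheroid /= => ->; left.
  (* The root c^2 = (d1 - d2)^2 is excluded, since (d1 - d2)^2 <= e < c^2. *)
  case=> [/eqP|h]; last by move: t1; rewrite -h leNgt ce.
  by rewrite eqrXn2 ?addr_ge0 // ?(ltW c0) // => /eqP ->.
move=> /andP[c0 ec] ->.
have ce : c ^+ 2 < e by rewrite -se ltr_sqr ?nnegrE // ltW.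
have [||s [b [b0 bs Q]]] := main c => //; first by rewrite lt_eqF.
exists s, b; split=> //; apply/seteqP.
split=> q; have /= [d1 d2 /andP[t1 t2] ->] := Q q.
  by rewrite /hyperboloid /= => <-; right; rewrite real_normK ?num_real.
(* Here c^2 = (d1 + d2)^2 is excluded, since c^2 < e <= (d1 + d2)^2. *)
case=> [h|/eqP]; first by move: t2; rewrite -h leNgt ce.
by rewrite -[(_ - _) ^+ 2]real_normK ?num_real // eqrXn2 // ?(ltW c0) // => /eqP ->.
Qed.

End FocalDistances.

(** * Tangent planes of the quadrics *)

Section QuadricTangent.
Variables (R : realType) (s b : R).
Local Notation Q := (quadratic s b).
Implicit Types q u v w : 'rV[R]_3.

Lemma is_derive_coord (g : R -> 'rV[R]_3) (x : R) u i :
  is_derive x 1 g u -> is_derive x 1 (fun t => g t 0 i) (u 0 i).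
Proof.
move=> [dg <-]; have := derivable_mxP g x 1; case=> /(_ dg 0 i) di _.
by apply: DeriveDef => //; rewrite derive_mx // mxE.
Qed.

Lemma quadric_tangent q u : Q q q = 1 ->
  tangent [set p | Q p p = 1] q u <-> Q q u = 0.
Proof.
move=> q1; split=> [[g [g0 gB dg]]|qu].
  have dx := is_derive_coord (inord 0) dg.
  have dy := is_derive_coord (inord 1) dg.
  have dz := is_derive_coord (inord 2) dg.
  pose X t := g t 0 (inord 0); pose Y t := g t 0 (inord 1).
  pose Z t := g t 0 (inord 2).
  have D1 : is_derive (0 : R) 1 (s *: (X * X) + b *: (Y * Y + Z * Z)) (2 * Q q u).
    apply: (is_derive_eq (is_deriveD (is_deriveZ s (is_deriveM dx dx))
      (is_deriveZ b (is_deriveD (is_deriveM dy dy) (is_deriveM dz dz))))).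
    rewrite -![_ *: _]/(_ * _) /X /Y /Z g0 /quadratic /cx /cy /cz; ring.
  (* Along a curve on the quadric Q(g, g) is constantly 1 near 0, so its derivative 2 Q(q, u)
     vanishes. *)
  have : is_derive (0 : R) 1 (cst 1 : R -> R) (2 * Q q u).
    apply: near_eq_is_derive D1; apply: filterS gB => t /=.
    by rewrite /quadratic /cx /cy /cz => <-; rewrite !fctE -mulrA.
  case=> _; rewrite derive_cst => /esym/eqP; rewrite mulf_eq0 pnatr_eq0 /=.
  by move/eqP.
(* The line q + t u is projected radially onto the quadric. *)
have qq t : Q (q + t *: u) (q + t *: u) = 1 + Q u u * t ^+ 2.
  transitivity (Q q q + 2 * t * Q q u + Q u u * t ^+ 2); last first.
    by rewrite q1 qu mulr0 addr0.
  by rewrite /quadratic !cE; ring.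
pose g t := 1 / Num.sqrt (1 + Q u u * t ^+ 2) ^+ 1.
have g0 : g 0 = 1 by rewrite /g expr0n mulr0 addr0 sqrtr1 expr1 divr1.
pose h (t : R) := 1 + Q u u * t ^+ 2.
have h0 : h 0 = 1 by rewrite /h expr0n mulr0 addr0.
have dh : is_derive (0 : R) 1 h 0.
  rewrite (_ : h = cst 1 + Q u u *: (id : R -> R) ^+ 2); last first.
    by apply/funext => t; rewrite !fctE.
  apply: (is_derive_eq (is_deriveD (is_derive_cst _ _ _)
    (is_deriveZ _ (is_deriveX 2 (is_derive_id _ _))))).
  by rewrite expr1 mulr0 scale0r scaler0 add0r.
(* The radial factor is stationary at 0, so the projected curve still has velocity u. *)
have dg : is_derive (0 : R) 1 g 0.
  have := @is_derive_over R 1 1 (h 0); rewrite h0 ltr01 => /(_ isT).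
  rewrite -{1}h0 => dk; apply: (is_derive_eq (is_derive1_comp dk dh)).
  exact: mulr0.
have dcoord i j :
    is_derive (0 : R) 1 (fun t => (g t *: (q + t *: u)) i j) (u i j).
  rewrite (_ : (fun t => _) = g * (cst (q i j) + (id : R -> R) * cst (u i j))).
    apply: (is_derive_eq (is_deriveM dg (is_deriveD (is_derive_cst _ _ _)
      (is_deriveM (is_derive_id _ _) (is_derive_cst _ _ _))))).
    rewrite g0 !scale1r !scaler0 !add0r addr0.
    exact: mulr1.
  by apply/funext => t; rewrite !fctE !mxE.
exists (fun t => g t *: (q + t *: u)); split.
- by rewrite g0 scale0r addr0 scale1r.
- have ch : {for 0, continuous h}.
    by apply/differentiable_continuous/derivable1_diffP; case: dh.
  have pos : \forall t \near (0 : R), 0 < h t.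
    by apply: (cvgr_gt (h 0) ch); rewrite h0.
  apply: filterS pos => t pt /=.
  transitivity (g t ^+ 2 * Q (q + t *: u) (q + t *: u)).
    by rewrite /quadratic !cE; ring.
  rewrite qq /g expr1 div1r exprVn sqr_sqrtr ?ltW // mulVf // gt_eqF //.
- have D : derivable (fun t => g t *: (q + t *: u)) 0 1.
    by apply/derivable_mxP => i j; have [] := dcoord i j.
  apply: DeriveDef => //; rewrite derive_mx //.
  by apply/matrixP => i j; rewrite mxE; have [_ ->] := dcoord i j.
Qed.

End QuadricTangent.

(** * Normals and invariance under reflection *)

Section Reflection.
Variable R : realType.

(** Since Q(q, q) = 1, the vector w - Q(q, w) q is tangent for every w. Hence g(n, w) = g(n, q) Q(q,
    w), and basis vectors w give the coordinates of n with l = g(n, q). *)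
Lemma quadric_normal (a s b : R) (q n : 'rV[R]_3) : quadratic s b q q = 1 ->
  normal (metric_W a) [set p | quadratic s b p p = 1] q n ->
  exists l, [/\ cx n = l * ((1 + a ^+ 2) * s * cx q), cy n = l * (b * cy q) &
                cz n = l * (b * cz q)].
Proof.
move=> q1 nn; exists (mdot (metric_W a) n q).
have H w : mdot (metric_W a) n w = quadratic s b q w * mdot (metric_W a) n q.
  have /nn : tangent [set p | quadratic s b p p = 1] q (w - quadratic s b q w *: q).
    apply/quadric_tangent => //.
    transitivity (quadratic s b q w - quadratic s b q w * quadratic s b q q).
      by rewrite /quadratic !cE; ring.
    by rewrite q1 mulr1 subrr.
  rewrite !mdot_W !cE => e; apply/eqP; rewrite -subr_eq0; apply/eqP.
  by rewrite -e; ring.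
have := H (vec3 1 0 0); have := H (vec3 0 1 0); have := H (vec3 0 0 1).
move: (mdot _ n q) => l; rewrite !mdot_W /quadratic !cE.
rewrite !(mulr0, mul0r, add0r, addr0, mulr1) => -> -> e.
split; [|ring|ring].
by rewrite (canRL (mulfVK (add1sqr_neq0 a)) e); ring.
Qed.

(* The polar form of the quadratic part of [E_sph]. *)
Definition spherical_dot (q u w : 'rV[R]_3) : R :=
  cx u * cx w + cy u * cy w + cz u * cz w
  + (cx q * cy u - cy q * cx u) * (cx q * cy w - cy q * cx w)
  + (cy q * cz u - cz q * cy u) * (cy q * cz w - cz q * cy w)
  + (cz q * cx u - cx q * cz u) * (cz q * cx w - cx q * cz w).

(* On a confocal quadric the normal is orthogonal to the tangent plane for
   both kinetic forms. *)
Lemma confocal_orthogonal (a s b : R) (q t n : 'rV[R]_3) (l : R) :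
  b != 0 -> b = s * (a ^+ 2 * b + 1 + a ^+ 2) ->
  quadratic s b q q = 1 -> quadratic s b q t = 0 ->
  cx n = l * ((1 + a ^+ 2) * s * cx q) -> cy n = l * (b * cy q) ->
  cz n = l * (b * cz q) -> spherical_dot q t n = 0.
Proof.
move=> b0 bs q1 qt nx ny nz; rewrite /spherical_dot nx ny nz.
move: q1 qt; rewrite /quadratic.
move: (cx q) (cy q) (cz q) (cx t) (cy t) (cz t) => x y z tx ty tz q1 qt.
pose T := y * ty + z * tz; pose r := y ^+ 2 + z ^+ 2.
(* After multiplication by b the form is an explicit combination of three vanishing quantities:
   tangency [E1], the quadric equation [E2] and the confocality relation. *)
apply/(mulfI b0); rewrite mulr0.
pose E1 := b * T + s * x * tx; pose E2 := b * r + s * x ^+ 2 - 1.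
have E10 : E1 = 0 by rewrite -qt /E1 /T; ring.
have E20 : E2 = 0 by rewrite /E2 -[X in _ - X]q1 /r; ring.
have E30 : a ^+ 2 * s * b + a ^+ 2 * s + s - b = 0 by rewrite [X in _ - X]bs; ring.
transitivity (l * (x * tx * (a ^+ 2 * s * b + a ^+ 2 * s + s - b)
  + a ^+ 2 * s * x * tx * E2 + b * E1 * (1 + x ^+ 2 + r)
  - (b - s) * x * tx * E2 - E1 * (1 + a ^+ 2 * s * x ^+ 2 + E2))).
  by rewrite /E1 /E2 /T /r; ring.
by rewrite E10 E20 E30; ring.
Qed.

(** The two energies change by twice the polar form of their kinetic part at (t, n), which is 0. For
    [L_yz], the (y, z) part of n is parallel to (y, z), so n contributes nothing. *)
Lemma reflection_invariant_W (a m1 m2 f : R) (B : set 'rV[R]_3) i : a != 0 ->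
  confocal_quadric (metric_W a) (vec3 a 0 0) (vec3 (- a) 0 0) B ->
  reflection_invariant (lagrange_system (metric_W a) (vec3 a 0 0)
    (vec3 (- a) 0 0) (vec3 0 0 0) m1 m2 f) B
    (eval (integral_expr a m1 m2 f i)).
Proof.
move=> a0 /(confocal_quadricE a0)[s [b [b0 bs ->]]] q v v' /= q1 _.
move=> [t [n [tt nn -> ->]]]; have tn := nn _ tt.
have [l [nx ny nz]] := quadric_normal q1 nn.
have qt := (quadric_tangent t q1).1 tt.
have sp := confocal_orthogonal b0 bs q1 qt nx ny nz.
apply: (integral_expr_ind (P := fun e => eval e (q, t + n) = eval e (q, t - n))).
- move: tn; rewrite /= mdot_W -!/(cx _) -!/(cy _) -!/(cz _) !cE => tn.
  congr (_ + _); apply/eqP; rewrite -subr_eq0; apply/eqP.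
  by rewrite -[RHS](mulr0 2) -tn; field; exact: add1sqr_neq0.
- move: sp; rewrite /spherical_dot /= -!/(cx _) -!/(cy _) -!/(cz _) !cE => sp.
  congr (_ + _); apply/eqP; rewrite -subr_eq0; apply/eqP.
  by rewrite -[RHS](mulr0 2) -sp; field.
- by rewrite /= -!/(cx _) -!/(cy _) -!/(cz _) !cE ny nz; ring.
Qed.

End Reflection.

Section NormalizedModel.
Variables (R : realType) (a m1 m2 f : R).

Let M := lagrange_system (metric_W a) (vec3 a 0 0) (vec3 (- a) 0 0)
  (vec3 0 0 0) m1 m2 f.

Lemma integrable_W (walls : set (set 'rV[R]_3)) : a != 0 ->
  (forall B, walls B ->
     confocal_quadric (metric_W a) (vec3 a 0 0) (vec3 (- a) 0 0) B) ->
  integrable_by M walls (fun i => eval (integral_expr a m1 m2 f i)).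
Proof.
move=> a0 HB; split.
- exact: first_integral_W.
- exact: independent_W.
- by move=> i j x; exact: involution_W.
- by move=> i B /HB; exact: reflection_invariant_W.
Qed.

End NormalizedModel.

(** * Reduction to the normalized model *)

Section Similarity.
Variable R : realType.

Lemma mdot_euclidean n (u v : 'rV[R]_n) : mdot 1%:M u v = \sum_i u 0 i * v 0 i.
Proof. by rewrite /mdot mulmx1 mxE; apply: eq_bigr => i _; rewrite mxE. Qed.

Lemma mdot1_eq0 n (u : 'rV[R]_n) : (mdot 1%:M u u == 0) = (u == 0).
Proof.
apply/eqP/eqP => [|->]; last by rewrite /mdot !mul0mx mxE.
rewrite mdot_euclidean => /psumr_eq0P H; apply/rowP => i; rewrite mxE.
have /eqP : u 0 i * u 0 i = 0 by apply: H => // j _; exact: sqr_ge0.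
by rewrite mulf_eq0 orbb => /eqP.
Qed.

(* H is the reflection in the hyperplane orthogonal to u - v; it is the identity
   if u = v. *)
Lemma householder n (u v : 'rV[R]_n) : mdot 1%:M u u = mdot 1%:M v v ->
  exists H : 'M[R]_n, H *m H^T = 1%:M /\ u *m H = v.
Proof.
move=> uv; set w := u - v; set W := mdot 1%:M w w.
have ww : w *m w^T = W%:M by rewrite [LHS]mx11_scalar /W /mdot mulmx1.
set S := w^T *m w; exists (1%:M - (2 / W) *: S).
have SS : S *m S = W *: S.
  by rewrite /S mulmxA -[_ *m w *m _]mulmxA ww mul_mx_scalar -scalemxAl.
have ST : S^T = S by rewrite /S trmx_mul trmxK.
have [W0|W0] := eqVneq W 0.
  have w0 : w = 0 by apply/eqP; rewrite -mdot1_eq0; apply/eqP.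
  rewrite /S w0 mulmx0 scaler0 subr0 trmx1 !mulmx1; split=> //.
  by apply/eqP; rewrite -subr_eq0 -/w w0.
split.
  have -> : (1%:M - (2 / W) *: S)^T = 1%:M - (2 / W) *: S.
    by apply/matrixP => i j; rewrite -[in RHS]ST !mxE eq_sym.
  rewrite mulmxBl mul1mx mulmxBr mulmx1.
  rewrite -!scalemxAl -!scalemxAr SS !scalerA.
  rewrite (_ : 2 / W * (2 / W) * W = 2 / W + 2 / W); last by field.
  by rewrite scalerDl opprB addrK subrK.
(* Equal norms give |u - v|^2 = 2 u.(u - v), so the reflection moves u by exactly w. *)
have uw : mdot 1%:M u w = W / 2.
  move: uv; rewrite /W !mdot_euclidean => uv.
  suff -> : \sum_i w 0 i * w 0 i = \sum_i u 0 i * w 0 i *+ 2.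
    by rewrite sumrMnl; field.
  apply/eqP; rewrite -subr_eq0 -sumrB.
  rewrite (eq_bigr (fun i => v 0 i * v 0 i - u 0 i * u 0 i)); last first.
    by move=> i _; rewrite !mxE mulr2n; ring.
  by rewrite sumrB uv subrr.
have uS : u *m S = (W / 2) *: w.
  rewrite /S mulmxA (_ : u *m w^T = (W / 2)%:M) ?mul_scalar_mx //.
  by rewrite [LHS]mx11_scalar -uw /mdot mulmx1.
rewrite mulmxBr mulmx1 -scalemxAr uS scalerA.
rewrite (_ : 2 / W * (W / 2) = 1); last by field.
by rewrite scale1r /w subKr.
Qed.

(** An orthogonal H turns u onto the x axis, D = diag(sqrt(1 + a^2), 1, 1) carries the metric of the
    model to the Euclidean one, and a scaling by c adjusts the length. *)
Lemma exists_similarity (a : R) (u : 'rV[R]_3) : a != 0 -> u != 0 ->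
  exists (P : 'M[R]_3) (k : R), [/\ P \in unitmx, 0 < k,
    euclidean R = k *: (P *m metric_W a *m P^T) & u *m P = vec3 a 0 0].
Proof.
move=> a0 u0; set h := Num.sqrt (1 + a ^+ 2).
have h2 : h ^+ 2 = 1 + a ^+ 2 by rewrite sqr_sqrtr // addr_ge0 ?sqr_ge0.
have h0 : h != 0 by rewrite -sqrf_eq0 h2 add1sqr_neq0.
set r := mnorm 1%:M u.
have uu0 : 0 <= mdot 1%:M u u.
  by rewrite mdot_euclidean sumr_ge0 // => i _; exact: sqr_ge0.
have r2 : r ^+ 2 = mdot 1%:M u u by rewrite sqr_sqrtr.
have r0 : r != 0 by rewrite -sqrf_eq0 r2 mdot1_eq0.
have [H [HH uH]] : exists H : 'M[R]_3, H *m H^T = 1%:M /\ u *m H = vec3 r 0 0.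
  apply: householder; rewrite -r2 mdot_euclidean sum_ord3.
  by rewrite -!/(cx _) -!/(cy _) -!/(cz _) !cE !mulr0 !addr0.
set D : 'M[R]_3 := diag_mx (vec3 h 1 1).
have DD : D *m metric_W a *m D^T = 1%:M.
  rewrite /D /metric_W tr_diag_mx !mulmx_diag -diag_const_mx; congr diag_mx.
  apply: vec3_eq; rewrite /cx /cy /cz !mxE !inordK //= ?mulr1 // -h2.
  by field.
(* The image of u under H (c D) is (c r h, 0, 0), which must be (a, 0, 0). *)
pose c := a / (r * h).
have c0 : c != 0 by rewrite /c mulf_neq0 ?invr_eq0 ?mulf_neq0.
exists (H *m (c *: D)), (c ^- 2).
have E : euclidean R =
    c ^- 2 *: (H *m (c *: D) *m metric_W a *m (H *m (c *: D))^T).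
  have XT : (H *m (c *: D))^T = c *: (D^T *m H^T).
    by rewrite -scalemxAr -trmx_mul; apply/matrixP => i j; rewrite !mxE.
  rewrite XT -!scalemxAr -!scalemxAl !scalerA.
  rewrite (_ : H *m D *m metric_W a *m (D^T *m H^T) = 1%:M); last first.
    by rewrite mulmxA -(mulmxA H D) -(mulmxA H _ D^T) DD mulmx1.
  by rewrite (_ : c ^- 2 * (c * c) = 1) ?scale1r //; field.
split=> //.
- by move: E; rewrite -(mulmxA _ (metric_W a)) scalemxAr => /esym/mulmx1_unit[].
- by rewrite invr_gt0 lt_def sqr_ge0 sqrf_eq0 c0.
- rewrite mulmxA uH -scalemxAr /D mul_mx_diag.
  apply: vec3_eq; rewrite cE; rewrite /cx /cy /cz !mxE !inordK //= ?mul0r ?mulr0 //.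
  by rewrite /c divfK // mulf_neq0.
Qed.

End Similarity.

(** * Arbitrary foci in Euclidean space *)

Section LagrangeEuclidean.
Variables (R : realType) (Z1 Z2 : 'rV[R]_3).
Hypothesis Z12 : Z1 <> Z2.

Let Z0 := 2^-1 *: (Z1 + Z2).

Lemma lagrange_integrable (m1 m2 f : R) (walls : set (set 'rV[R]_3)) :
  (forall B, walls B -> confocal_quadric (euclidean R) Z1 Z2 B) ->
  billiard_integrable (lagrange_system (euclidean R) Z1 Z2 Z0 m1 m2 f) walls.
Proof.
move=> HB; have u0 : Z1 - Z0 != 0.
  apply/eqP => e; apply: Z12; apply/eqP; rewrite -subr_eq0; apply/eqP.
  rewrite -[RHS](scaler0 _ 2) -e /Z0 scalerBr scalerA mulfV ?pnatr_eq0 // scale1r.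
  by rewrite scaler_nat mulr2n opprD addrACA subrr add0r.
have [P [k [uP k0 metE PZ]]] := exists_similarity (oner_neq0 R) u0.
have PZ1 : affine P Z0 Z1 = vec3 1 0 0 by [].
have PZ2 : affine P Z0 Z2 = vec3 (- 1) 0 0.
  rewrite /affine (_ : Z2 - Z0 = - (Z1 - Z0)).
    by rewrite mulNmx PZ; apply: vec3_eq; rewrite !cE ?oppr0.
  apply/eqP; rewrite -subr_eq0 opprK; apply/eqP.
  rewrite addrACA -opprD -[Z0 + Z0]mulr2n -scaler_nat /Z0 scalerA mulfV ?pnatr_eq0 //.
  by rewrite scale1r [Z2 + _]addrC subrr.
have PZ0 : affine P Z0 Z0 = vec3 0 0 0.
  by rewrite /affine subrr mul0mx; apply: vec3_eq; rewrite !cE.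
set h := Num.sqrt k; have h0 : 0 < h by rewrite sqrtr_gt0.
have hk : h ^+ 2 = k by rewrite sqr_sqrtr ?ltW.
have distE p q : mdist (euclidean R) p q =
    h * mdist (metric_W 1) (affine P Z0 p) (affine P Z0 q).
  rewrite /mdist /mnorm /h -sqrtrM ?ltW //; congr Num.sqrt.
  rewrite (_ : affine P Z0 p - affine P Z0 q = (p - q) *m P).
    by rewrite metE /mdot -scalemxAr -scalemxAl mxE trmx_mul !mulmxA.
  by rewrite /affine -mulmxBl opprB addrA subrK.
(* The model is taken with a = 1. Distances scale by h and k = h^2, so m / (h d) = k (m / (h k)) / d
   rescales the masses, while f k d^2 leaves f unchanged. *)
pose N := lagrange_system (metric_W 1) (vec3 1 0 0) (vec3 (- 1) 0 0)
  (vec3 0 0 0) (m1 / (h * k)) (m2 / (h * k)) f.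
(* All confocal quadrics of the model serve as walls at once, so each given wall only has to be
   matched with one of them. *)
pose wallsN : set (set 'rV[R]_3) := [set B |
  confocal_quadric (metric_W 1) (vec3 1 0 0) (vec3 (- 1) 0 0) B].
have iN := @integrable_W R 1 (m1 / (h * k)) (m2 / (h * k)) f wallsN
  (oner_neq0 R) (fun B HB => HB).
pose F i := eval (integral_expr 1 (m1 / (h * k)) (m2 / (h * k)) f i).
exists (fun i => F i \o phase_map P Z0).
have k_neq0 : k != 0 by rewrite gt_eqF.
have h_neq0 : h != 0 by rewrite gt_eqF.
apply: (@integrable_T R 2 (lagrange_system (euclidean R) Z1 Z2 Z0 m1 m2 f) N P
  Z0 k uP k_neq0 _ metE _ _ _ walls wallsN F).
- exact: metric_W_unit.
- move=> q /=; rewrite /kepler_force /hooke_force !distE PZ1 PZ2 PZ0.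
  rewrite exprMn hk !invfM.
  move: (mdist _ _ _)^-1 (mdist _ _ (vec3 (- 1) 0 0))^-1 (mdist _ _ _ ^+ 2).
  move=> d1 d2 d0.
  move: k h k_neq0 h_neq0 {metE k0 h0 hk distE N iN F} => k' h' ? ?.
  by field; apply/andP.
- have sE Z m q : kepler_singular Z m q <->
      kepler_singular (affine P Z0 Z) (m / (h * k)) (affine P Z0 q).
    rewrite /kepler_singular /= mulf_eq0 invr_eq0 mulf_eq0.
    rewrite (negbTE h_neq0) (negbTE k_neq0) !orbF.
    by split=> -[m0 e]; split=> //; [rewrite e|exact: (can_inj (affineK Z0 uP))].
  move=> q /=; rewrite -PZ1 -PZ2; split=> -[H|H].
  + by left; exact: (sE _ _ _).1 H.
  + by right; exact: (sE _ _ _).1 H.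
  + by left; exact: (sE _ _ _).2 H.
  + by right; exact: (sE _ _ _).2 H.
- exact: differentiable_force.
- exact: conserved_W.
- exact: iN.
- move=> B /HB HBB; rewrite /wallsN /=.
  (* A quadric with constant c corresponds to the model quadric with constant c / h. *)
  have c_h c : c = h * (c / h) by rewrite mulrC divfK.
  case: HBB => -[c]; rewrite distE PZ1 PZ2.
    rewrite mulrC -ltr_pdivlMr // => dc ->.
    exists (spheroid (metric_W 1) (vec3 1 0 0) (vec3 (- 1) 0 0) (c / h)).
      by left; exists (c / h).
    apply/seteqP; split=> q; rewrite /spheroid /= !distE PZ1 PZ2 -mulrDr.
      by move=> <-; rewrite [h * _]mulrC mulfK.
    by move=> ->; rewrite -c_h.
  rewrite [h * _]mulrC -ltr_pdivrMr // => /andP[c0 dc] ->.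
  exists (hyperboloid (metric_W 1) (vec3 1 0 0) (vec3 (- 1) 0 0) (c / h)).
    by right; exists (c / h); rewrite // divr_gt0.
  apply/seteqP; split=> q; rewrite /hyperboloid /= !distE PZ1 PZ2 -mulrBr;
    rewrite normrM (gtr0_norm h0).
    by move=> <-; rewrite [h * _]mulrC mulfK.
  by move=> ->; rewrite -c_h.
Qed.

(** * The two-center, Kepler and Hooke problems as Lagrange problems with vanishing parameters *)

Let hooke0 : hooke_force (euclidean R) Z0 0 = fun=> 0.
Proof. by apply/funext => q; rewrite /hooke_force mul0r. Qed.

Let kepler0 Z : kepler_force (euclidean R) Z 0 = fun=> 0.
Proof. by apply/funext => q; rewrite /kepler_force mul0r. Qed.

Let singular0 (Z : 'rV[R]_3) : kepler_singular Z 0 = set0.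
Proof. by apply/seteqP; split=> q // -[]; rewrite eqxx. Qed.

Lemma two_center_lagrange (m1 m2 : R) :
  two_center_system (euclidean R) Z1 Z2 m1 m2 =
  lagrange_system (euclidean R) Z1 Z2 Z0 m1 m2 0.
Proof.
rewrite /two_center_system /lagrange_system hooke0; congr MechSystem.
by apply/funext => q; rewrite addr0.
Qed.

Lemma kepler1_lagrange (m : R) :
  kepler_system (euclidean R) Z1 m =
  lagrange_system (euclidean R) Z1 Z2 Z0 m 0 0.
Proof.
rewrite /kepler_system /lagrange_system hooke0 kepler0 singular0 setU0.
by congr MechSystem; apply/funext => q; rewrite !addr0.
Qed.

Lemma kepler2_lagrange (m : R) :
  kepler_system (euclidean R) Z2 m =
  lagrange_system (euclidean R) Z1 Z2 Z0 0 m 0.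
Proof.
rewrite /kepler_system /lagrange_system hooke0 kepler0 singular0 set0U.
by congr MechSystem; apply/funext => q; rewrite add0r addr0.
Qed.

Lemma hooke_lagrange (f : R) :
  hooke_system (euclidean R) Z0 f =
  lagrange_system (euclidean R) Z1 Z2 Z0 0 0 f.
Proof.
rewrite /hooke_system /lagrange_system !kepler0 !singular0 setU0.
by congr MechSystem; apply/funext => q; rewrite !add0r.
Qed.

End LagrangeEuclidean.

Theorem theorem2 (R : realType) :
  (forall (Z1 Z2 : 'rV[R]_3) (walls : set (set 'rV[R]_3)),
     Z1 <> Z2 ->
     finite_set walls ->
     (forall B, walls B -> confocal_quadric (euclidean R) Z1 Z2 B) ->
     let Z0 := 2^-1 *: (Z1 + Z2) in
     [/\ forall m1 m2 f : R,
           billiard_integrable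
             (lagrange_system (euclidean R) Z1 Z2 Z0 m1 m2 f) walls,
         forall m1 m2 : R,
           billiard_integrable
             (two_center_system (euclidean R) Z1 Z2 m1 m2) walls,
         (forall m1 : R,
            billiard_integrable (kepler_system (euclidean R) Z1 m1) walls) /\
         (forall m2 : R,
            billiard_integrable (kepler_system (euclidean R) Z2 m2) walls) &
         forall f : R,
           billiard_integrable (hooke_system (euclidean R) Z0 f) walls])
  /\
  (forall (a m1 m2 f : R) (walls : set (set 'rV[R]_3)),
     a != 0 ->
     finite_set walls ->
     (forall B, walls B ->
        confocal_quadric (metric_W a) (vec3 a 0 0) (vec3 (- a) 0 0) B) ->
     integrable_by
       (lagrange_system (metric_W a) (vec3 a 0 0) (vec3 (- a) 0 0)
          (vec3 0 0 0) m1 m2 f)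
       walls
       (tnth [tuple E_sp a m1 m2 f; E_sph a m1 m2 f; @L_yz R])).
Proof.
split=> [Z1 Z2 walls Z12 _ HB|a m1 m2 f walls a0 _ HB].
  move=> Z0; split=> [m1 m2 f|m1 m2||f].
  - exact: lagrange_integrable.
  - by rewrite (two_center_lagrange Z1 Z2); exact: lagrange_integrable.
  (* The other focus becomes a centre of mass 0: it exerts no force and is not singular. *)
  - split=> m.
      by rewrite (kepler1_lagrange Z1 Z2); exact: lagrange_integrable.
    by rewrite (kepler2_lagrange Z1 Z2); exact: lagrange_integrable.
  - by rewrite (hooke_lagrange Z1 Z2); exact: lagrange_integrable.
rewrite (_ : tnth _ = fun i => eval (integral_expr a m1 m2 f i)).
  exact: integrable_W.
by apply/funext => i; exact: integralE.
Qed.
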